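(* Let $\alpha\in(0,1)$, $\gamma,\varepsilon,T>0$, let $u_0\in H^2(\Omega)\cap H_0^1(\Omega)$, and let $u$ be the solution on $(0,T)\times\Omega$ of the time-fractional Allen--Cahn problem $\partial_t^\alpha u=\gamma(\varepsilon^2\Delta u-f(u))$, $u(0,\cdot)=u_0$, with homogeneous Dirichlet boundary condition, where $f(u)=u^3-u$. For $\beta\in\{\alpha,\alpha+1\}$ set $$D_\beta(t)=\frac{\|u(t)-u(0)\|^2}{2t^\beta}+\frac{\beta}{2}\int_0^t\frac{\|u(t)-u(\tau)\|^2}{(t-\tau)^{\beta+1}}\,d\tau .$$ Then for every $t\in(0,T]$ the quantities $D_\alpha(t)$ and $D_{\alpha+1}(t)$ are well defined (finite), and $$\Gamma(1-\alpha)\,\langle\partial_t^\alpha u(t),\partial_t u(t)\rangle=\frac{d}{dt}D_\alpha(t)+\alpha D_{\alpha+1}(t).$$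
   Context: $\Omega\subset\mathbb{R}^d$ is a bounded domain with sufficiently regular boundary; $\langle\cdot,\cdot\rangle$ and $\|\cdot\|$ are the inner product and norm of $L^2(\Omega)$; $u(t)=u(t,\cdot)$. The Caputo derivative of order $\alpha\in(0,1)$ is $\partial_t^\alpha u(t)=\frac{1}{\Gamma(1-\alpha)}\int_0^t\frac{\partial_\tau u(\tau)}{(t-\tau)^\alpha}\,d\tau$, $t>0$. For $u_0\in H^2(\Omega)\cap H_0^1(\Omega)$ and $T>0$ the solution of the Dirichlet problem is the unique solution with the following (known) regularity: $u\in H^\alpha(0,T;L^2(\Omega))\cap L^2(0,T;H^2(\Omega)\cap H_0^1(\Omega))$, $u\in L^\infty((0,T)\times\Omega)$, $u\in C^\alpha([0,T];L^2(\Omega))\cap C([0,T];H^2(\Omega)\cap H_0^1(\Omega))$, $\partial_t^\alpha u\in C([0,T];L^2(\Omega))$, $\partial_t u\in C((0,T];L^2(\Omega))$, and $\|\partial_t u(t)\|\le Ct^{\alpha-1}$ for $t\in(0,T]$, with a constant $C$ depending on $u_0$ and $T$. *)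

(* Defs.v *)
(* R is an arbitrary realType, and R^n is 'rV[R]_n. *)
From HB Require Import structures.
From mathcomp Require Import all_boot all_order all_algebra.
From mathcomp Require Import all_classical all_reals all_analysis.

Set Implicit Arguments.
Unset Strict Implicit.
Unset Printing Implicit Defensive.

Import Order.TTheory GRing.Theory Num.Theory.
Import numFieldNormedType.Exports.

Local Open Scope classical_set_scope.
Local Open Scope ring_scope.

Section LebesgueMeasure.
Context (R : realType) (d : nat).
Local Notation point := 'rV[R]_d.+1.

Definition box (ab : point * point) : set point :=
  [set x | forall i, ab.1 ord0 i <= x ord0 i < ab.2 ord0 i].

Definition box_volume (ab : point * point) : R :=
  \prod_i Num.max (ab.2 ord0 i - ab.1 ord0 i) 0.

(* The dimension is written d.+1: in dimension 0 no box is empty, and this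
   formula would not give measure 0 to set0. *)
Definition lebesgue_outer (A : set point) : \bar R :=
  ereal_inf [set (\sum_(k <oo) (box_volume (F k))%:E)%E
            | F in [set F : nat -> point * point | A `<=` \bigcup_k box (F k)]].

Lemma box_volume_ge0 ab : 0 <= box_volume ab.
Proof. by apply: prodr_ge0 => i _; rewrite le_max lexx orbT. Qed.

Let vol_ge0 ab : (0 <= (box_volume ab)%:E)%E.
Proof. by rewrite lee_fin box_volume_ge0. Qed.

Let lebesgue_outer_ge0 A : (0 <= lebesgue_outer A)%E.
Proof. by apply: le_ereal_inf_tmp => _ [F _ <-]; exact: nneseries_ge0. Qed.

Let lebesgue_outer0 : lebesgue_outer set0 = 0%E.
Proof.
apply/eqP; rewrite eq_le lebesgue_outer_ge0 andbT.
apply: ereal_inf_lbound; exists (fun=> (0, 0)) => //=.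
rewrite eseries0// => k _ _; congr (_%:E).
by rewrite /box_volume (bigD1 ord0)//= subrr maxxx mul0r.
Qed.

Let le_lebesgue_outer : {homo lebesgue_outer : A B / A `<=` B >-> (A <= B)%E}.
Proof.
move=> A B AB; apply: le_ereal_inf_tmp => _ [F BF <-].
by apply: ereal_inf_lbound; exists F => //; exact: subset_trans BF.
Qed.

Let lebesgue_outer_subadditive : sigma_subadditive lebesgue_outer.
Proof.
move=> A; have [[i ioo]|] := pselect (exists i, lebesgue_outer (A i) = +oo%E).
  rewrite (eseries_pinfty _ _ ioo) ?leey// => n _.
  by rewrite -ltNye (lt_le_trans _ (lebesgue_outer_ge0 _)).
rewrite -forallNE => Aoo.
suff add2e (e : {posnum R}) : (lebesgue_outer (\bigcup_n A n) <=
    \sum_(i <oo) lebesgue_outer (A i) + e%:num%:E)%E.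
  by apply/lee_addgt0Pr => _/posnumP[].
rewrite (le_trans _ (epsilon_trick _ _ _))//.
pose P n (F : nat -> point * point) := A n `<=` \bigcup_k box (F k) /\
  (\sum_(k <oo) (box_volume (F k))%:E <=
   lebesgue_outer (A n) + (e%:num / (2 ^ n.+1)%:R)%:E)%E.
have [G PG] : {G & forall n, P n (G n)}.
  apply: (@choice _ _ P) => n; rewrite /P.
  have fA : lebesgue_outer (A n) \is a fin_num.
    by rewrite ge0_fin_numE// ltey; apply/eqP; exact: Aoo.
  have en1 : 0 < e%:num / (2 ^ n.+1)%:R :> R by [].
  have [_ [F AF <-] lF] := lb_ereal_inf_adherent en1 fA.
  by exists F; split => //; exact/ltW.
pose w (x : nat * nat) := (box_volume (uncurry G x))%:E.
have w_ge0 x : (0 <= w x)%E by exact: vol_ge0.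
apply: (@le_trans _ _ (\esum_(i in setT) w i)%E).
  apply: ereal_inf_lbound => /=.
  have /card_esym/ppcard_eqP[f] := card_nat2.
  exists (uncurry G \o f).
    move=> t [i _ /(PG i).1[j _ Gt]]; exists (f^-1%FUN (i, j)) => //=.
    by rewrite invK ?inE.
  rewrite -(esum_pred_image w _ xpredT) ?[fun=> _]set_true//.
  by rewrite image_eq.
rewrite (_ : esum _ _ = \sum_(i <oo) \sum_(j <oo) w (i, j))%E; last first.
  pose J : nat -> set (nat * nat) := fun i => [set (i, j) | j in setT].
  rewrite (_ : setT = \bigcup_k J k); last first.
    by rewrite predeqE => -[a b]; split => // _; exists a => //; exists b.
  rewrite esum_bigcupT /=; last 2 first.
  - apply/trivIsetP => i j _ _ ij.
    rewrite predeqE => -[n m] /=; split => //= -[] [_] _ [<-{n} _].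
    by move=> [m' _] [] /esym/eqP; rewrite (negbTE ij).
  - by [].
  rewrite -(image_id [set: nat]) -fun_true esum_pred_image//; last first.
    by move=> n _; exact: esum_ge0.
  apply: eq_eseriesr => /= j _.
  rewrite -(esum_pred_image w (pair j) predT)//=; last first.
    by move=> ? ? _ _; exact: (@can_inj _ _ _ snd).
  by congr esum; rewrite predeqE => -[a b]; split; move=> [i _ <-]; exists i.
apply: lee_lim.
- by apply: is_cvg_nneseries => n *; apply: nneseries_ge0.
- by apply: is_cvg_nneseries => n *; apply: adde_ge0.
- by near=> n; apply: lee_sum => i _; exact: (PG i).2.
Unshelve. all: by end_near. Qed.

HB.instance Definition _ := isOuterMeasure.Build R point lebesgue_outer
  lebesgue_outer0 lebesgue_outer_ge0 le_lebesgue_outer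
  lebesgue_outer_subadditive.

Definition lebesgue_rV :
    {measure set (caratheodory_type lebesgue_outer) -> \bar R} :=
  [the {measure set (caratheodory_type lebesgue_outer) -> \bar R} of
   (lebesgue_outer : {outer_measure set point -> \bar R})
   : set (caratheodory_type lebesgue_outer) -> \bar R].

End LebesgueMeasure.

Section Domain.
Context (R : realType) (d : nat).
Local Notation point := 'rV[R]_d.+1.

(* Near each boundary point, Omega is the set of points that lie, in some unit
   direction e, above the graph of a Lipschitz function on the hyperplane
   orthogonal to e; this function is extended to be constant along e. *)
Definition lipschitz_boundary (Omega : set point) :=
  forall x, (closure Omega `\` interior Omega) x ->
  exists (e : point) (g : point -> R),
    [/\ \sum_i e ord0 i ^+ 2 = 1,
        lipschitz g,
        (forall y s, g (y + s *: e) = g y) &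
        \forall y \near x, Omega y <-> g y < \sum_i y ord0 i * e ord0 i].

Definition bounded_domain (Omega : set point) :=
  [/\ open Omega, connected Omega, Omega !=set0 & bounded_set Omega].

End Domain.

(* Elements of L^2(Omega) are functions on the whole space; only their values
   almost everywhere in Omega matter. *)
Section Sobolev.
Context (R : realType) (d : nat) (Omega : set 'rV[R]_d.+1).
Local Notation point := 'rV[R]_d.+1.
Local Notation leb := (lebesgue_rV R d).
Implicit Types f g phi : point -> R.

Definition L2 : set (point -> R) := [set f | f \_ Omega \in Lfun leb 2%:E].

Definition L2inner f g : R := \int[leb]_(x in Omega) (f x * g x).

Definition L2norm f : R := Num.sqrt (L2inner f f).

Definition eqL2 f g := {ae leb, forall x, Omega x -> f x = g x}.

(* A multi-index is given as the sequence of the differentiation directions. *)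
Definition pderiv (s : seq 'I_d.+1) phi : point -> R :=
  foldr (fun i (g : point -> R) => 'D_(delta_mx ord0 i : point) g) phi s.

Definition test_function phi :=
  [/\ forall s x, differentiable (pderiv s phi) x,
      compact (closure [set x | phi x != 0]) &
      closure [set x | phi x != 0] `<=` Omega].

Definition is_weak_deriv (s : seq 'I_d.+1) f g :=
  forall phi, test_function phi ->
    L2inner f (pderiv s phi) = (-1) ^+ size s * L2inner g phi.

Definition weak_deriv (s : seq 'I_d.+1) f : point -> R :=
  xget 0 [set g | L2 g /\ is_weak_deriv s f g].

Definition Hk (k : nat) : set (point -> R) := [set f | L2 f /\
  forall s : seq 'I_d.+1, (size s <= k)%N ->
    exists2 g, L2 g & is_weak_deriv s f g].

Definition Hnorm (k : nat) f : R :=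
  Num.sqrt (\sum_(m < k.+1) \sum_(s : m.-tuple 'I_d.+1)
    L2norm (weak_deriv s f) ^+ 2).

Definition H10 : set (point -> R) := [set f | Hk 1 f /\
  exists2 phi : nat -> point -> R, forall k, test_function (phi k) &
    Hnorm 1 (phi k - f) @[k --> \oo] --> (0 : R)].

Definition laplacian f : point -> R := \sum_i weak_deriv [:: i; i] f.

End Sobolev.

(* Functions of time with values in a function space, which is given by its
   carrier S and its norm N (a seminorm on functions that are not yet
   identified almost everywhere). *)
Section VectorValued.
Context (R : realType) (V : lmodType R) (S : set V) (N : V -> R).
Local Notation mu := (@lebesgue_measure R).
Implicit Types (D : set R) (u g : R -> V) (t : R) (v w : V).

Definition cont_on D u := forall t, D t ->
  S (u t) /\ N (u s - u t) @[s --> within D (nbhs t)] --> (0 : R).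

(* One-sided when t is an end point of the interval D. *)
Definition is_deriv_on D u t v :=
  N ((s - t)^-1 *: (u s - u t) - v) @[s --> within D t^'] --> (0 : R).

Definition deriv_on D u t : V :=
  xget 0 [set v | S v /\ is_deriv_on D u t v].

Record simple_map := SimpleMap {
  steps : nat;
  step_set : nat -> set R;
  step_value : nat -> V }.

Definition simple_on D (h : simple_map) :=
  forall i, (i < steps h)%N ->
  [/\ measurable (step_set h i), step_set h i `<=` D,
      (mu (step_set h i) < +oo)%E & S (step_value h i)].

Definition simple_fun (h : simple_map) (t : R) : V :=
  \sum_(i < steps h) \1_(step_set h i) t *: step_value h i.

Definition simple_integral (h : simple_map) : V :=
  \sum_(i < steps h) fine (mu (step_set h i)) *: step_value h i.

Definition strongly_measurable D g :=
  exists2 h : nat -> simple_map, forall k, simple_on D (h k) &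
    {ae mu, forall t, D t ->
       S (g t) /\ N (simple_fun (h k) t - g t) @[k --> \oo] --> (0 : R)}.

(* The approximating simple functions converge to g in the mean, which makes g
   strongly measurable. *)
Definition is_bochner_integral D g w :=
  [/\ S w, forall t, D t -> S (g t) &
  exists h : nat -> simple_map,
    [/\ forall k, simple_on D (h k),
        forall k, mu.-integrable D (fun t => (N (simple_fun (h k) t - g t))%:E),
        (\int[mu]_(t in D) (N (simple_fun (h k) t - g t))%:E)%E
          @[k --> \oo] --> 0%E &
        N (simple_integral (h k) - w) @[k --> \oo] --> (0 : R)]].

Definition bochner_integrable D g := exists w, is_bochner_integral D g w.

Definition bochner_integral D g : V := xget 0 (is_bochner_integral D g).

Definition L2_time D u := strongly_measurable D u /\
  (\int[mu]_(t in D) (N (u t) ^+ 2)%:E < +oo)%E.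

Definition Halpha_time (alpha : R) D u := L2_time D u /\
  (\int[mu]_(t in D) \int[mu]_(s in D)
     (N (u t - u s) ^+ 2 / `|t - s| `^ (1 + 2 * alpha))%:E < +oo)%E.

End VectorValued.

Definition Gamma (R : realType) (x : R) : R :=
  \int[lebesgue_measure]_(s in `]0, +oo[) (s `^ (x - 1) * expR (- s)).

Section AllenCahn.
Context (R : realType) (d : nat) (Omega : set 'rV[R]_d.+1).
Local Notation point := 'rV[R]_d.+1.
Local Notation leb := (lebesgue_rV R d).
Implicit Types (alpha beta gamma epsilon T t : R) (u : R -> point -> R).

Definition time_deriv T u t : point -> R :=
  deriv_on (L2 Omega) (L2norm Omega) `[0, T] u t.

Definition caputo_integrand alpha T u t (tau : R) : point -> R :=
  (t - tau) `^ (- alpha) *: time_deriv T u tau.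

Definition caputo alpha T u t : point -> R :=
  (Gamma (1 - alpha))^-1 *:
  bochner_integral (L2 Omega) (L2norm Omega) `]0, t[
    (caputo_integrand alpha T u t).

(* L^oo((0,T) x Omega), with respect to Lebesgue measure in dimension d.+2 *)
Definition Linfty_spacetime T u :=
  let Q := [set z : 'rV[R]_(1 + d.+1) |
             (0 < lsubmx z ord0 ord0 < T) /\ Omega (rsubmx z)] in
  exists2 U : 'rV[R]_(1 + d.+1) -> R,
    U \_ Q \in Lfun (lebesgue_rV R d.+1) +oo%E &
    {ae lebesgue_measure, forall t, `]0, T[%classic t ->
       eqL2 Omega (fun x => U (row_mx (const_mx t) x)) (u t)}.

Record regular_solution alpha T u : Prop := RegularSolution {
  regular_Halpha : Halpha_time (L2 Omega) (L2norm Omega) alpha `]0, T[ u;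
  regular_L2H2 :
    L2_time (Hk Omega 2 `&` H10 Omega) (Hnorm Omega 2) `]0, T[ u;
  regular_Linfty : Linfty_spacetime T u;
  regular_Calpha : exists C : R, forall s t, s \in `[0, T] -> t \in `[0, T] ->
    L2 Omega (u t) /\ L2norm Omega (u t - u s) <= C * `|t - s| `^ alpha;
  regular_CH2 :
    cont_on (Hk Omega 2 `&` H10 Omega) (Hnorm Omega 2) `[0, T] u;
  regular_caputo_defined : forall t, t \in `]0, T] ->
    bochner_integrable (L2 Omega) (L2norm Omega) `]0, t[
      (caputo_integrand alpha T u t);
  (* At t = 0 the Caputo derivative is understood by continuous extension. *)
  regular_caputo : exists2 w : R -> point -> R,
    cont_on (L2 Omega) (L2norm Omega) `[0, T] w &
    forall t, t \in `]0, T] -> eqL2 Omega (w t) (caputo alpha T u t);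
  regular_deriv_defined : forall t, t \in `]0, T] -> exists2 v, L2 Omega v &
    is_deriv_on (L2norm Omega) `[0, T] u t v;
  regular_deriv :
    cont_on (L2 Omega) (L2norm Omega) `]0, T] (time_deriv T u);
  regular_deriv_bound : exists C : R, forall t, t \in `]0, T] ->
    L2norm Omega (time_deriv T u t) <= C * t `^ (alpha - 1) }.

Record allen_cahn_solution alpha gamma epsilon T (u0 : point -> R) u : Prop :=
  AllenCahnSolution {
  solution_regular : regular_solution alpha T u;
  solution_eq : forall t, t \in `]0, T[ ->
    eqL2 Omega (caputo alpha T u t)
      (fun x => gamma * (epsilon ^+ 2 * laplacian Omega (u t) x -
                         (u t x ^+ 3 - u t x)));
  solution_init : eqL2 Omega (u 0) u0;
  solution_dirichlet : forall t, t \in `[0, T] -> H10 Omega (u t) }.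

Definition D_integrand beta u t (tau : R) : R :=
  L2norm Omega (u t - u tau) ^+ 2 / (t - tau) `^ (beta + 1).

Definition D_functional beta u t : R :=
  L2norm Omega (u t - u 0) ^+ 2 / (2 * t `^ beta) +
  beta / 2 * \int[lebesgue_measure]_(tau in `]0, t[) D_integrand beta u t tau.

End AllenCahn.

(* Main.v *)
From HB Require Import structures.
Require Import Defs.
From mathcomp Require Import all_boot all_order all_algebra.
From mathcomp Require Import all_classical all_reals all_analysis.
From mathcomp Require Import measurable_realfun ring lra.

Set Implicit Arguments.
Unset Strict Implicit.
Unset Printing Implicit Defensive.

Import Order.TTheory GRing.Theory Num.Theory.
Import numFieldNormedType.Exports.

Local Open Scope classical_set_scope.
Local Open Scope ring_scope.

(** Write N for the norm, v for the time derivative of u, and fix t. Formally,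
    differentiating the integral in D_alpha in t gives
      2 <u t - u tau, v t> (t - tau)^(-alpha-1)
        - (alpha + 1) N(u t - u tau)^2 (t - tau)^(-alpha-2)
    under the integral; the terms in which a power of time is differentiated
    are cancelled by alpha D_(alpha+1), and an integration by parts in tau turns
    what is left into
      int_0^t (t - tau)^(-alpha) <v tau, v t> dtau,
    which is Gamma(1 - alpha) times the pairing of the Caputo derivative with
    v t.

    The singularity of the kernel moves with t, so this computation is not a
    legitimate differentiation under the integral. The substitution
    tau = t r fixes the singularity at r = 1 and gives
      D_alpha(s) = s^(-alpha) / 2 * (N(u s - u 0)^2 + alpha J(s)),
      J(s) = int_0^1 N(u s - u (s r))^2 (1 - r)^(-alpha-1) dr.
    The price is that the derivative of the integrand now involves v (s r),
    which is only known to be at most C (s r)^(alpha-1). Since N(u s - u (s r))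
    is at most K (1 - r), uniformly for s away from 0, the difference quotients
    of the integrand of J are dominated by a multiple of the integrable Beta
    kernel r^(alpha-1) (1 - r)^(-alpha), and dominated convergence
    differentiates J (history_derive).

    In the variable r the identity then says that one explicit combination of
    integrands integrates to <u t - u 0, v t>. That combination is the
    derivative of
      - <u t - u (t r), v t> (1 - r)^(-alpha)
        - alpha / (2 t) r N(u t - u (t r))^2 (1 - r)^(-alpha-1),
    which tends to - <u t - u 0, v t> at r = 0 and to 0 at r = 1, so the claim
    is an improper fundamental theorem of calculus (history_identity).

    The argument uses nothing about L^2(Omega) beyond its semi-inner product,
    and it is carried out for a curve in an arbitrary semi-inner product space
    (caputo_energy_identity). Bounded functionals commute with the Bochner
    integral that defines the Caputo derivative (bochner_functional), which
    brings the theorem back to that scalar identity; one also needs that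
    Gamma(1 - alpha) is positive and finite (Gamma_gt0). *)

(** * Integrals over open intervals *)

Section Integration.
Context {R : realType}.
Local Notation mu := (@lebesgue_measure R).
Implicit Types (a b t : R) (f F : R -> R).

Lemma continuous_itv_measurable a b f :
  {in `]a, b[, continuous f} -> measurable_fun `]a, b[ f.
Proof.
move=> cf; apply: open_continuous_measurable_fun; first exact: interval_open.
by move=> x; rewrite inE => /cf.
Qed.

Lemma le_integrable_itv a b f g :
  {in `]a, b[, continuous f} -> mu.-integrable `]a, b[ (EFin \o g) ->
  (forall x, x \in `]a, b[ -> `|f x| <= g x) ->
  mu.-integrable `]a, b[ (EFin \o f).
Proof.
move=> cf ig fg; apply: le_integrable ig => //.
  by apply/measurable_EFinP; exact: continuous_itv_measurable.
by move=> x /= xab; rewrite lee_fin (le_trans (fg _ xab))// ler_norm.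
Qed.

(** Scaling the Lebesgue measure by a factor t and pushing it forward along the
    multiplication by t gives the Lebesgue measure again, since this holds on
    half-open intervals. *)
Lemma integral_scale t (f : R -> \bar R) : 0 < t ->
  measurable_fun `]0, t[ f -> (forall x, 0 < x < t -> (0 <= f x)%E) ->
  (\int[mu]_(x in `]0%R, t[) f x = t%:E * \int[mu]_(r in `]0%R, 1%R[) f (t * r)%R)%E.
Proof.
move=> t0 mf f0.
have mt : measurable_fun [set: measurableTypeR R]
    ( *%R t : measurableTypeR R -> measurableTypeR R).
  exact: mulrl_measurable.
pose nut : {measure set (measurableTypeR R) -> \bar R} :=
  @pushforward _ _ (measurableTypeR R) (measurableTypeR R) R mu ( *%R t).
pose nu : {measure set (measurableTypeR R) -> \bar R} :=
  mscale (NngNum (ltW t0)) (nut mt).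
have preim (i : interval R) : ( *%R t) @^-1` [set` i] =
    [set` Interval (match i.1 with BSide c x => BSide c (x / t) | BInfty c => BInfty _ c end)
                   (match i.2 with BSide c x => BSide c (x / t) | BInfty c => BInfty _ c end)].
  have lt_t c x y : (BSide c x <= BLeft (t * y))%O = (BSide c (x / t) <= BLeft y)%O.
    by case: c; rewrite !bnd_simp ?ler_pdivrMr ?ltr_pdivrMr// mulrC.
  have gt_t c x y : (BRight (t * y) <= BSide c x)%O = (BRight y <= BSide c (x / t))%O.
    by case: c; rewrite !bnd_simp ?ler_pdivlMr ?ltr_pdivlMr// mulrC.
  apply/seteqP; split=> x /=; case: i => -[c i|c] [c' j|c'] /=;
  by rewrite !itv_boundlr /= ?lt_t ?gt_t.
have eqmu A : measurable A -> mu A = nu A.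
  apply: (@lebesgue_measure_unique R nu) => _ [[a b] _ <-] /=.
  rewrite /nu /mscale/= /pushforward preim/=.
  rewrite [LHS]lebesgue_measure_itv [X in (_ = _ * X)%E]lebesgue_measure_itv/=.
  rewrite !lte_fin ltr_pM2r ?invr_gt0//; case: ifPn => _; last by rewrite mule0.
  by rewrite -EFinM mulrBr !(mulrC t) !divfK ?gt_eqF.
rewrite (eq_measure_integral nu); last by move=> A mA _; exact: eqmu.
rewrite ge0_integral_mscale//; congr (_ * _)%E.
rewrite ge0_integral_pushforward//; last first.
  by move=> y; rewrite inE/= in_itv; exact: f0.
by rewrite preim/= mul0r divff ?gt_eqF.
Qed.

Lemma integrable_scale t f : 0 < t -> measurable_fun `]0, t[ f ->
  mu.-integrable `]0, 1[ (EFin \o (fun r => f (t * r))) ->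
  mu.-integrable `]0, t[ (EFin \o f) /\
  \int[mu]_(x in `]0, t[) f x = t * \int[mu]_(r in `]0, 1[) f (t * r).
Proof.
move=> t0 /measurable_EFinP mf if1; split.
  apply/integrableP; split=> //=.
  rewrite (@integral_scale t (fun x => `|(f x)%:E|%E))//; last first.
    exact: measurableT_comp.
  rewrite lte_mul_pinfty ?lee_fin ?ltW//.
  by case/integrableP: if1.
rewrite /Rintegral integralE [in RHS]integralE.
have -> : (\int[mu]_(x in `]0%R, t[) (fun x => (f x)%:E)^\+ x =
    t%:E * \int[mu]_(r in `]0%R, 1%R[) (fun r => (f (t * r)%R)%:E)^\+ r)%E.
  rewrite (@integral_scale t ((fun x => (f x)%:E)^\+)%E)//.
    by congr (_ * _)%E; apply: eq_integral => r _; rewrite !funeposE.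
  by apply: measurable_funepos; exact: mf.
have -> : (\int[mu]_(x in `]0%R, t[) (fun x => (f x)%:E)^\- x =
    t%:E * \int[mu]_(r in `]0%R, 1%R[) (fun r => (f (t * r)%R)%:E)^\- r)%E.
  rewrite (@integral_scale t ((fun x => (f x)%:E)^\-)%E)//.
    by congr (_ * _)%E; apply: eq_integral => r _; rewrite !funenegE.
  by apply: measurable_funeneg; exact: mf.
rewrite -muleBr// ?fineM//.
- by rewrite fin_numB integrable_pos_fin_num// integrable_neg_fin_num.
- by rewrite fin_num_adde_defl// fin_numN integrable_neg_fin_num.
Qed.

Lemma FTC2_inner a b c d f F : a < c -> c < d -> d < b ->
  {in `]a, b[, continuous f} ->
  (forall x, x \in `]a, b[ -> is_derive x 1 F (f x)) ->
  (\int[mu]_(x in `[c, d]) (f x)%:E = (F d - F c)%:E)%E.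
Proof.
move=> ac cd db cf dF.
have ab x : x \in `[c, d] -> x \in `]a, b[.
  by rewrite !in_itv/= => /andP[cx xd]; rewrite (lt_le_trans ac)// (le_lt_trans xd).
have cF x : x \in `[c, d] -> {for x, continuous F}.
  by move=> /ab /dF dFx; apply/differentiable_continuous/derivable1_diffP.
rewrite (@continuous_FTC2 _ f F)//.
- by apply: continuous_in_subspaceT => x; rewrite inE => /ab /cf.
- split.
  + move=> x /subset_itv_oo_cc /ab /dF dFx; exact: ex_derive.
  + by apply: cvg_at_right_filter; apply: cF; rewrite in_itv/= lexx ltW.
  + by apply: cvg_at_left_filter; apply: cF; rewrite in_itv/= lexx ltW.
- by move=> x /subset_itv_oo_cc /ab /dF dFx; rewrite derive1E derive_val.
Qed.

(** The compact intervals obtained by removing this margin at both ends exhaust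
    the open interval; the factor 1/3 keeps all of them nondegenerate. *)
Let margin a b n : R := (b - a) / 3 * n.+1%:R^-1.

Let margin_bnd a b n : a < b -> 0 < margin a b n <= (b - a) / 3.
Proof.
move=> ab; have ba3 : 0 < (b - a) / 3 by rewrite divr_gt0// subr_gt0.
rewrite /margin mulr_gt0 ?invr_gt0//= ger_pMr//.
by rewrite invf_le1// ler1n.
Qed.

Let margin_cvg a b : margin a b n @[n --> \oo] --> 0.
Proof.
rewrite -(mulr0 ((b - a) / 3)); apply: cvgM; first exact: cvg_cst.
exact: cvg_harmonic.
Qed.

Let inner a b n : set R := `[a + margin a b n, b - margin a b n].

Let inner_cvg a b f x : a < b -> x \in `]a, b[ ->
  ((EFin \o f) \_ (inner a b n)) x @[n --> \oo] --> (f x)%:E.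
Proof.
move=> ab; rewrite in_itv/= => /andP[ax xb]; apply: cvg_near_cst.
have /cvgr0_norm_lt/(_ (Num.min (x - a) (b - x))) := @margin_cvg a b.
rewrite lt_min !subr_gt0 ax xb => /(_ isT); apply: filterS => n.
rewrite gtr0_norm; last by case/andP: (margin_bnd n ab).
rewrite lt_min => /andP[h1 h2]; rewrite patchE ifT// inE /inner/= in_itv/=.
by apply/andP; split; lra.
Qed.

Let inner_sub a b n : a < b -> inner a b n `<=` `]a, b[.
Proof.
move=> ab x; have /andP[m0 m3] := margin_bnd n ab.
by rewrite /inner/= !in_itv/= => /andP[h1 h2]; apply/andP; split; lra.
Qed.

Let integral_inner a b n f F : a < b -> {in `]a, b[, continuous f} ->
  (forall x, x \in `]a, b[ -> is_derive x 1 F (f x)) ->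
  (\int[mu]_(x in `]a, b[) ((EFin \o f) \_ (inner a b n)) x =
  (F (b - margin a b n) - F (a + margin a b n))%:E)%E.
Proof.
move=> ab cf dF; have /andP[m0 m3] := margin_bnd n ab.
rewrite -integral_mkcondr setIidr; last exact: inner_sub.
by apply: (@FTC2_inner a b) => //; lra.
Qed.

Let measurable_inner a b n f : a < b -> {in `]a, b[, continuous f} ->
  measurable_fun `]a, b[ ((EFin \o f) \_ (inner a b n)).
Proof.
move=> ab cf; apply/(measurable_restrict _ _ _).1 => //.
  exact: measurable_itv.
apply/measurable_EFinP; apply: measurable_funS (continuous_itv_measurable cf) => //.
Qed.

(** Dominated convergence, with f itself as the dominating function, passes to
    the limit in the fundamental theorem on the exhausting compact intervals. *)
Lemma improper_FTC2 a b f F la lb : a < b -> {in `]a, b[, continuous f} ->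
  (forall x, x \in `]a, b[ -> is_derive x 1 F (f x)) ->
  mu.-integrable `]a, b[ (EFin \o f) ->
  F x @[x --> a^'+] --> la -> F x @[x --> b^'-] --> lb ->
  \int[mu]_(x in `]a, b[) f x = lb - la.
Proof.
move=> ab cf dF intf Fa Fb.
have [|||||| _ _] := @dominated_convergence _ _ _ mu `]a, b[ _
  (fun n => (EFin \o f) \_ (inner a b n)) (EFin \o f) (abse \o (EFin \o f)).
- by [].
- by move=> n; exact: measurable_inner.
- exact: measurable_int intf.
- by apply: aeW => x /=; exact: inner_cvg.
- exact: integrable_abse.
- apply: aeW => x n _ /=; rewrite patchE; case: ifP => //= _.
  by rewrite normr0 lee_fin.
rewrite /=; have -> : (fun n => (\int[mu]_(x in `]a, b[) ((EFin \o f) \_ (inner a b n)) x)%E) =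
    EFin \o (fun n => F (b - margin a b n) - F (a + margin a b n)).
  by apply/funext => n; rewrite (integral_inner _ _ cf dF).
rewrite -(fineK (integrable_fin_num _ intf))// => /fine_cvg h.
apply: (cvg_unique _ h) => //=.
apply: cvgB.
- move/cvg_at_leftP : Fb; apply; split.
    by move=> n; have /andP[] := margin_bnd n ab; lra.
  rewrite -[X in _ --> X]subr0; apply: cvgB; first exact: cvg_cst.
  exact: margin_cvg.
- move/cvg_at_rightP : Fa; apply; split.
    by move=> n; have /andP[] := margin_bnd n ab; lra.
  rewrite -[X in _ --> X]addr0; apply: cvgD; first exact: cvg_cst.
  exact: margin_cvg.
Qed.

(** By Fatou's lemma, the integral of f is at most the lower limit of its
    integrals over the compact intervals, which are increments of F. *)
Lemma ge0_improper_integrable a b f F M : a < b -> {in `]a, b[, continuous f} ->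
  (forall x, x \in `]a, b[ -> is_derive x 1 F (f x)) ->
  (forall x, x \in `]a, b[ -> 0 <= f x) ->
  (forall x, x \in `]a, b[ -> `|F x| <= M) ->
  mu.-integrable `]a, b[ (EFin \o f).
Proof.
move=> ab cf dF f0 FM; apply/integrableP; split.
  by apply/measurable_EFinP; exact: continuous_itv_measurable.
have -> : (\int[mu]_(x in `]a, b[) `|(EFin \o f) x| = \int[mu]_(x in `]a, b[)
    limn_einf (fun n => ((EFin \o f) \_ (inner a b n)) x))%E.
  apply: eq_integral => x; rewrite inE/= => xab.
  by rewrite (cvg_limn_einf_sup (inner_cvg ab xab)).1 ger0_norm// f0.
apply: (@le_lt_trans _ _ (M + M)%:E); last exact: ltry.
apply: (le_trans (fatou _ _ _ _)) => //.
- by move=> n; exact: measurable_inner.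
- move=> n x xab; rewrite patchE; case: ifP => //= _.
  by rewrite lee_fin f0.
rewrite limn_einf_lim; apply: lime_le; first exact: is_cvg_einfs.
apply: nearW => n; apply: le_trans (ereal_inf_lbound _) _; first by exists n => /=.
rewrite (integral_inner _ _ cf dF)// lee_fin (le_trans (ler_norm _))//.
by rewrite (le_trans (ler_normB _ _))// lerD// FM// in_itv/=;
  have /andP[? ?] := margin_bnd n ab; apply/andP; split; lra.
Qed.

End Integration.

(** * Difference quotients and dominated limits *)

Section RealLimits.
Context {R : realType}.
Local Notation mu := (@lebesgue_measure R).
Implicit Types (A B W : set R) (t x : R) (f g : R -> R).
(** Lets a limit along a restricted set of times be computed on a smaller set
    that agrees with it near t. *)
Lemma within_dnbhs_local A B W t : nbhs t W -> A `&` W `<=` B ->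
  within A t^' --> within B t^'.
Proof.
move=> Wt AWB P BP; change (nbhs t (fun s => s != t -> A s -> P s)).
by apply: filterS2 Wt BP => s Ws BP st As; apply: BP => //; exact: AWB.
Qed.

Lemma within_dnbhs_nbhs A t : within A t^' --> t.
Proof.
move=> P tP; change (nbhs t (fun s => s != t -> A s -> P s)).
by apply: filterS tP => s Ps _ _.
Qed.

(** The derivative as the limit of (f y - f x) / (y - x), the form in which
    difference quotients of vector-valued curves come. *)
Lemma is_derive_dnbhs f x (df : R) :
  (y - x)^-1 * (f y - f x) @[y --> x^'] --> df -> is_derive x 1 f df.
Proof.
move=> fx.
have H : h^-1 *: ((f \o shift x) (h *: (1 : R)) - f x) @[h --> 0^'] --> df.
  have hx : h + x @[h --> (0 : R)^'] --> x^'.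
    move=> P [e /= e0 eP]; exists e => //= h /=; rewrite sub0r normrN => he h0.
    apply: (eP (h + x)); last by rewrite -subr_eq0 addrK.
    by rewrite /= (addrC h) opprD addrA subrr sub0r normrN.
  apply: cvg_trans (cvg_comp _ _ hx fx).
  by apply: near_eq_cvg; apply: nearW => h /=; rewrite addrK [h *: _]mulr1.
by split; [apply/cvg_ex; exists df|exact: cvg_lim H].
Qed.

Lemma dnbhs_is_derive f x (df : R) : is_derive x 1 f df ->
  (y - x)^-1 * (f y - f x) @[y --> x^'] --> df.
Proof.
move=> dfx.
have H : h^-1 *: ((f \o shift x) (h *: (1 : R)) - f x) @[h --> 0^'] --> df.
  have /cvg_ex[l fl] : derivable f x 1 by exact: ex_derive.
  have <- : 'D_1 f x = df by exact: derive_val.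
  by rewrite /derive (cvg_lim _ fl).
have hx : y - x @[y --> x^'] --> (0 : R)^'.
  move=> P [e /= e0 eP]; exists e => //= y /=; rewrite distrC => ye yx.
  by apply: (eP (y - x)); rewrite /= ?sub0r ?normrN// subr_eq0.
apply: cvg_trans (cvg_comp _ _ hx H).
by apply: near_eq_cvg; apply: nearW => h /=; rewrite [_ *: 1]mulr1 subrK.
Qed.

Lemma cvg_quotientM A t f g (df dg : R) :
  (s - t)^-1 * (f s - f t) @[s --> within A t^'] --> df ->
  (s - t)^-1 * (g s - g t) @[s --> within A t^'] --> dg ->
  (s - t)^-1 * (f s * g s - f t * g t) @[s --> within A t^'] -->
    df * g t + f t * dg.
Proof.
move=> fq gq.
have st : (s - t) @[s --> within A t^'] --> (0 : R).
  rewrite -(subrr t); apply: cvgB; last exact: cvg_cst.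
  exact: within_dnbhs_nbhs.
have fqs : (s - t)^-1 * (f s - f t) * (s - t) @[s --> within A t^'] --> (0 : R).
  by rewrite -(mulr0 df); exact: cvgM.
have -> : df * g t + f t * dg = df * g t + 0 * dg + f t * dg by rewrite mul0r addr0.
apply: (@cvg_trans _ (((s - t)^-1 * (f s - f t) * g t +
   (s - t)^-1 * (f s - f t) * (s - t) * ((s - t)^-1 * (g s - g t)) +
   f t * ((s - t)^-1 * (g s - g t))) @[s --> within A t^'])); last first.
  apply: cvgD; [apply: cvgD|]; apply: cvgM => //; exact: cvg_cst.
apply: near_eq_cvg; change (nbhs t (fun s => s != t -> A s -> 
   (s - t)^-1 * (f s - f t) * g t +
   (s - t)^-1 * (f s - f t) * (s - t) * ((s - t)^-1 * (g s - g t)) +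
   f t * ((s - t)^-1 * (g s - g t)) = (s - t)^-1 * (f s * g s - f t * g t))).
by apply: (@filterE _ (nbhs t)) => s st0 _; field; rewrite subr_eq0.
Qed.

(** Heine's criterion: the punctured neighbourhood filters have a countable
    base, and sequences are what dominated convergence can handle. *)
Lemma cvg_within_dnbhs (A : set R) t (f : R -> R) (l : R) :
  (forall s : nat -> R, (forall n, A (s n)) -> (forall n, s n != t) ->
     s n @[n --> \oo] --> t -> f (s n) @[n --> \oo] --> l) ->
  f s @[s --> within A t^'] --> l.
Proof.
move=> seqf; apply/cvgrPdist_lt => e e0; apply: contrapT => nearf.
have /choice[s sP] : forall n, exists s, [/\ A s, s != t,
    `|t - s| < n.+1%:R^-1 & e <= `|l - f s|].
  move=> n; apply: contrapT => nos; apply: nearf.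
  apply/nbhs_ballP; exists n.+1%:R^-1 => /=; first by rewrite invr_gt0.
  move=> s /= ts st As; rewrite ltNge; apply/negP => le.
  by apply: nos; exists s.
have st : s n @[n --> \oo] --> t.
  apply/cvgrPdist_lt => d d0; near=> n.
  have [_ _ /lt_trans -> //] := sP n.
  near: n; exact: (near_infty_natSinv_lt (PosNum d0)).
have := seqf s (fun n => let: And4 h _ _ _ := sP n in h)
  (fun n => let: And4 _ h _ _ := sP n in h) st.
move=> /cvgrPdist_lt/(_ _ e0)[n _ /(_ n (leqnn n))] /=.
by have [_ _ _ le] := sP n; rewrite ltNge le.
Unshelve. all: by end_near. Qed.

Lemma dominated_cvg_within (B : set R) (A : set R) t (h : R -> R -> R)
    (l e : R -> R) : measurable B ->
  (forall s, A s -> s != t -> measurable_fun B (h s)) -> measurable_fun B l ->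
  (forall r, B r -> h s r @[s --> within A t^'] --> l r) ->
  mu.-integrable B (EFin \o e) ->
  (forall s r, A s -> s != t -> B r -> `|h s r| <= e r) ->
  (\int[mu]_(r in B) h s r) @[s --> within A t^'] --> \int[mu]_(r in B) l r.
Proof.
move=> mB mh ml hl ie he; apply: cvg_within_dnbhs => s As st scvg.
have wst : s n @[n --> \oo] --> within A t^'.
  move=> P [d /= d0 dP]; move/cvgrPdist_lt : scvg => /(_ _ d0).
  by apply: filterS => n tsn; apply: dP => //=.
have [n|||||il _] := @dominated_convergence _ _ _ mu B mB
  (fun n => EFin \o h (s n)) (EFin \o l) (EFin \o e).
- by apply/measurable_EFinP; exact: mh.
- exact/measurable_EFinP.
- apply: aeW => r Br /=; apply: cvg_EFin; first exact: nearW.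
  exact: (cvg_comp _ _ wst (hl r Br)).
- by [].
- by apply: aeW => r n Br; rewrite lee_fin he.
by rewrite /= -(fineK (integrable_fin_num _ il))// => /fine_cvg.
Qed.

End RealLimits.

(** * Real powers, the Beta kernel and the Gamma function *)

Section Powers.
Context {R : realType}.
Local Notation mu := (@lebesgue_measure R).
Lemma powR_continuous (p x : R) : 0 < x -> {for x, continuous (@powR R ^~ p)}.
Proof.
move=> x0; apply/differentiable_continuous/derivable1_diffP.
by have ? := is_derive1_powR p x0; exact: ex_derive.
Qed.

Lemma is_derive_powR_onem (p x : R) : x < 1 ->
  is_derive x 1 (fun y => (1 - y) `^ p) (- (p * (1 - x) `^ (p - 1))).
Proof.
move=> x1; have x0 : 0 < 1 - x by rewrite subr_gt0.
have d1 : is_derive x (1 : R) (fun y : R => 1 - y) (-1).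
  rewrite -sub0r; exact: (@is_deriveB R R^o R^o (cst (1 : R)) id).
by have := @is_derive1_comp _ (@powR R ^~ p) (fun y => 1 - y) x _ _
  (is_derive1_powR p x0) d1; rewrite mulrN1.
Qed.

Lemma powR_onem_continuous (p x : R) : x < 1 ->
  {for x, continuous (fun y : R => (1 - y) `^ p)}.
Proof.
move=> x1; apply/differentiable_continuous/derivable1_diffP.
by have ? := is_derive_powR_onem p x1; exact: ex_derive.
Qed.

Lemma powR_le_inv (x p : R) : 0 < x <= 1 -> p <= 1 -> x `^ (- p) <= x^-1.
Proof.
move=> x01 p1; have /andP[x0 _] := x01.
by rewrite powRN lef_pV2 ?posrE ?powR_gt0// ger1_powR.
Qed.

Lemma integrable_powR p : 0 < p ->
  mu.-integrable `]0, 1[ (EFin \o (fun x => x `^ (p - 1))).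
Proof.
move=> p0; apply: (@ge0_improper_integrable _ _ _ _ (fun x => p^-1 * x `^ p) p^-1) => //.
- by move=> x; rewrite in_itv/= => /andP[x0 _]; exact: powR_continuous.
- move=> x; rewrite in_itv/= => /andP[x0 _].
  have := @is_deriveZ R R^o R^o (@powR R ^~ p) p^-1 x 1 _ (is_derive1_powR p x0).
  by rewrite /GRing.scale/= mulrA mulVf ?gt_eqF// mul1r.
- by move=> x _; exact: powR_ge0.
- move=> x; rewrite in_itv/= => /andP[x0 x1].
  rewrite ger0_norm ?mulr_ge0 ?powR_ge0 ?invr_ge0 ?(ltW p0)//.
  by rewrite ger_pMr ?invr_gt0// -[leRHS](powRr0 x) ger_powR ?x0 ?(ltW x1)// ltW.
Qed.

Lemma integrable_powR_onem p : 0 < p ->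
  mu.-integrable `]0, 1[ (EFin \o (fun x => (1 - x) `^ (p - 1))).
Proof.
move=> p0; apply: (@ge0_improper_integrable _ _ _ _ (fun x => - p^-1 * (1 - x) `^ p) p^-1) => //.
- by move=> x; rewrite in_itv/= => /andP[_ x1]; exact: powR_onem_continuous.
- move=> x; rewrite in_itv/= => /andP[_ x1].
  have := @is_deriveZ R R^o R^o (fun y : R => (1 - y) `^ p) (- p^-1) x 1 _
    (is_derive_powR_onem p x1).
  by rewrite /GRing.scale/= mulrNN mulrA mulVf ?gt_eqF// mul1r.
- by move=> x _; exact: powR_ge0.
- move=> x; rewrite in_itv/= => /andP[x0 x1].
  rewrite mulNr normrN ger0_norm ?mulr_ge0 ?powR_ge0 ?invr_ge0 ?(ltW p0)//.
  rewrite ger_pMr ?invr_gt0// -[leRHS](powRr0 (1 - x)) ger_powR ?(ltW p0)//.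
  by apply/andP; split; lra.
Qed.

Lemma norm_powR_cvg0 (p t : R) : 0 < p -> `|s - t| `^ p @[s --> t] --> (0 : R).
Proof.
move=> p0; apply/cvgr0Pnorm_lt => e e0.
exists (e `^ p^-1) => /=; first by rewrite powR_gt0.
move=> s /=; rewrite distrC => st; rewrite ger0_norm ?powR_ge0//.
have -> : e = (e `^ p^-1) `^ p by rewrite -powRrM mulVf ?gt_eqF// powRr1// ltW.
by rewrite gt0_ltr_powR// nnegrE ?powR_ge0.
Qed.

Lemma ler_powR_neg (p x y : R) : 0 <= p -> 0 < x <= y -> y `^ (- p) <= x `^ (- p).
Proof.
move=> p0 /andP[x0 xy]; have y0 := lt_le_trans x0 xy.
by rewrite !powRN lef_pV2 ?posrE ?powR_gt0// ge0_ler_powR// nnegrE ltW.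
Qed.

Lemma powR_oppS (p x : R) : 0 < x -> x `^ (- (p + 1)) = x `^ (- p) / x.
Proof.
move=> x0; rewrite opprD powRD; last by rewrite (gt_eqF x0) implybT.
by rewrite powR_inv1// ltW.
Qed.

(** Integrand of the Beta function at (alpha, 1 - alpha); it dominates every
    integral over ]0, 1[ in the proof. *)
Definition beta_kernel (alpha r : R) : R := r `^ (alpha - 1) * (1 - r) `^ (- alpha).

Lemma beta_kernel_continuous alpha :
  {in `]0, 1[, continuous (beta_kernel alpha)}.
Proof.
move=> r; rewrite in_itv/= => /andP[r0 r1].
by apply: cvgM; [exact: powR_continuous|exact: powR_onem_continuous].
Qed.

(** Only one of the two singularities matters on each half of the interval: the
    other factor is at most 2 there. *)
Lemma integrable_beta_kernel alpha : 0 < alpha < 1 ->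
  mu.-integrable `]0, 1[ (EFin \o beta_kernel alpha).
Proof.
move=> /andP[a0 a1].
apply: (@le_integrable_itv _ _ _ _ (fun r => 2 * r `^ (alpha - 1) + 2 * (1 - r) `^ (- alpha))).
- exact: beta_kernel_continuous.
- rewrite (_ : _ \o _ =
      ((fun r : R => 2%:E * (EFin \o (fun x : R => x `^ (alpha - 1))%R) r) \+
      (fun r : R => 2%:E * (EFin \o (fun x : R => (1 - x) `^ (- alpha))%R) r))%E)//.
  apply: integrableD => //; apply: integrableZl => //; first exact: integrable_powR.
  have := @integrable_powR_onem (1 - alpha).
  by rewrite addrAC subrr sub0r subr_gt0; exact.
- move=> r; rewrite in_itv/= => /andP[r0 r1].
  rewrite ger0_norm ?mulr_ge0 ?powR_ge0//.
  have h1 : r `^ (alpha - 1) <= r^-1.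
    by rewrite -opprB powR_le_inv ?r0 ?ltW//; lra.
  have h2 : (1 - r) `^ (- alpha) <= (1 - r)^-1.
    by rewrite powR_le_inv ?subr_gt0 ?r1//; lra.
  have p1 := powR_ge0 r (alpha - 1); have p2 := powR_ge0 (1 - r) (- alpha).
  have [rh|rh] := leP 2^-1 r.
    have : r^-1 <= 2 by rewrite invf_ple ?posrE.
    rewrite /beta_kernel; nra.
  have : (1 - r)^-1 <= 2 by rewrite invf_ple ?posrE; lra.
  rewrite /beta_kernel; nra.
Qed.

Lemma beta_kernel_ge (alpha r : R) : 0 < alpha < 1 -> 0 < r < 1 ->
  (1 - r) `^ (- alpha) <= beta_kernel alpha r.
Proof.
move=> /andP[a0 a1] /andP[r0 r1]; rewrite ler_peMl ?powR_ge0//.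
by rewrite -[leLHS](powRr0 r) ger_powR ?r0 ?ltW//; lra.
Qed.

(** A divergent integral would count as 0, so finiteness has to be shown: the
    integrand is below s^(x-1) on ]0, 1[ and below exp(-s) beyond 1. It is at
    least exp(-1) on ]0, 1[. *)
Lemma Gamma_gt0 (x : R) : 0 < x <= 1 -> 0 < Gamma x.
Proof.
move=> /andP[x0 x1]; pose g (s : R) := s `^ (x - 1) * expR (- s).
have dexp (s : R) : is_derive s (1 : R) (fun s => - expR (- s)) (expR (- s)).
  have dN : is_derive s (1 : R) (fun s : R => - s) (-1).
    exact: (@is_deriveN R R^o R^o id).
  have := is_derive1_comp (is_derive_expR (- s)) dN.
  by move=> /(@is_deriveN R R^o R^o); rewrite mulrN1 opprK.
have cexp : continuous (fun s : R => expR (- s)).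
  by move=> s; apply: continuous_comp; [exact: continuousN|exact: continuous_expR].
have mg D : measurable_fun D (EFin \o g).
  apply/measurable_EFinP; apply: measurable_funM.
    by apply: measurable_funTS; exact: measurable_powR.
  by apply: measurable_funTS; exact: continuous_measurable_fun.
have g0 s : 0 <= g s by rewrite mulr_ge0 ?powR_ge0 ?expR_ge0.
have Efin : (\int[mu]_(s in `]0%R, +oo[) (g s)%:E < +oo)%E.
  have -> : `]0, +oo[%classic = `]0, 1[%classic `|` `[1, +oo[%classic :> set R.
    by apply/seteqP; split=> s /=; rewrite !in_itv/= ?andbT; case: (ltP s 1) => ? // ;
      [left|right|case|case] => // *; lra.
  rewrite ge0_integral_setU//=; last 2 first.
  - by move=> s _; rewrite lee_fin.
  - by apply/disj_setPS => s /=; rewrite !in_itv/= => -[/andP[_ ?]]; rewrite andbT; lra.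
  apply: lte_add_pinfty.
  - have /integrableP[_] := integrable_powR x0; apply: le_lt_trans.
    apply: ge0_le_integral => //=.
    + by move=> s _; rewrite lee_fin.
    + exact: mg.
    + apply/measurable_EFinP; apply: measurableT_comp => //.
      by apply: measurable_funTS; exact: measurable_powR.
    + move=> s; rewrite in_itv/= => /andP[s0 s1]; rewrite lee_fin ger0_norm ?powR_ge0//.
      by rewrite ler_piMr ?powR_ge0// -expR0 ler_expR; lra.
  - apply: (@le_lt_trans _ _ (\int[mu]_(s in `[1%R, +oo[) (expR (- s))%:E)%E).
      apply: ge0_le_integral => //=.
      + by move=> s _; rewrite lee_fin.
      + exact: mg.
      + by apply/measurable_EFinP; apply: measurable_funTS; exact: continuous_measurable_fun.
      + move=> s; rewrite in_itv/= andbT => s1; rewrite lee_fin ler_piMl ?expR_ge0//.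
        by rewrite -[leRHS](powRr0 s) ler_powR//; lra.
    rewrite (@ge0_continuous_FTC2y _ _ (fun s => - expR (- s)) _ 0) ?ltry//.
    + exact: continuous_subspaceT.
    + rewrite -oppr0; apply: cvgN; exact: cvgr_expR.
    + by apply: cvgN; apply/cvg_at_right_filter; exact: cexp.
    + by move=> s _; rewrite derive1E; have := dexp s => ?; rewrite derive_val.
  exact: mg.
rewrite -lte_fin /Gamma /Rintegral fineK; last first.
  rewrite ge0_fin_numE; first exact: Efin.
  by apply: integral_ge0 => s _; rewrite lee_fin; exact: g0.
apply: (@lt_le_trans _ _ (\int[mu]_(s in `]0%R, 1%R[) (expR (-1))%:E)%E).
  by rewrite integral_cst//= lebesgue_measure_itv/= lte_fin ltr01 sube0 mule1 lte_fin expR_gt0.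
apply: (@le_trans _ _ (\int[mu]_(s in `]0%R, 1%R[) (g s)%:E)%E).
  apply: ge0_le_integral => //=.
  + exact: mg.
  + move=> s; rewrite in_itv/= => /andP[s0 s1]; rewrite lee_fin /g.
    apply: (@le_trans _ _ (expR (- s))); first by rewrite ler_expR; lra.
    rewrite ler_peMl ?expR_ge0// -[leLHS](powRr0 s) ger_powR ?s0 ?(ltW s1)//; lra.
apply: ge0_subset_integral => //=.
- exact: mg.
- by move=> s _; rewrite lee_fin.
- by move=> s /=; rewrite !in_itv/= => /andP[->].
Qed.

End Powers.

(** * Semi-inner products *)

(** Definiteness is left out: functions that agree almost everywhere are not
    identified. *)
Record semi_inner (R : realType) (E : lmodType R) (ip : E -> E -> R) : Prop :=
  SemiInner {
  ipC : forall x y, ip x y = ip y x;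
  ip_linear : forall a x y z, ip (a *: x + y) z = a * ip x z + ip y z;
  ip_ge0 : forall x, 0 <= ip x x }.

Section SemiInnerTheory.
Context {R : realType} {E : lmodType R} {ip : E -> E -> R}.
Context (ipP : semi_inner ip).
Implicit Types (x y z : E) (a : R).

Definition ipnorm x : R := Num.sqrt (ip x x).
Local Notation N := ipnorm.

Lemma ip0l z : ip 0 z = 0.
Proof.
have := ip_linear ipP 1 0 0 z; rewrite scaler0 addr0 mul1r => /eqP.
by rewrite eq_sym -subr_eq0 addrK => /eqP.
Qed.

Lemma ipZl a x z : ip (a *: x) z = a * ip x z.
Proof. by rewrite -[a *: x]addr0 (ip_linear ipP) ip0l addr0. Qed.

Lemma ipDl x y z : ip (x + y) z = ip x z + ip y z.
Proof. by rewrite -[x]scale1r (ip_linear ipP) mul1r scale1r. Qed.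

Lemma ipNl x z : ip (- x) z = - ip x z.
Proof. by rewrite -scaleN1r ipZl mulN1r. Qed.

Lemma ipBl x y z : ip (x - y) z = ip x z - ip y z.
Proof. by rewrite ipDl ipNl. Qed.

Lemma ipZr a x z : ip z (a *: x) = a * ip z x.
Proof. by rewrite (ipC ipP) ipZl (ipC ipP). Qed.

Lemma ipDr x y z : ip z (x + y) = ip z x + ip z y.
Proof. by rewrite (ipC ipP) ipDl !((ipC ipP) z). Qed.

Lemma ipBr x y z : ip z (x - y) = ip z x - ip z y.
Proof. by rewrite (ipC ipP) ipBl !((ipC ipP) z). Qed.

Lemma ip_sqrB x y : ip x x - ip y y = ip (x + y) (x - y).
Proof. by rewrite ipBr !ipDl ((ipC ipP) y x); lra. Qed.

Lemma ipnorm_ge0 x : 0 <= N x. Proof. exact: sqrtr_ge0. Qed.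

Lemma sqr_ipnorm x : N x ^+ 2 = ip x x.
Proof. by rewrite sqr_sqrtr// (ip_ge0 ipP). Qed.

Lemma ip_CauchySchwarz x y : `|ip x y| <= N x * N y.
Proof.
have sq a : 0 <= ip x x + 2 * a * ip x y + a ^+ 2 * ip y y.
  have := ip_ge0 ipP (x + a *: y).
  by rewrite ipDl !ipDr !ipZl !ipZr (ipC ipP y x); lra.
rewrite -sqrtrM ?(ip_ge0 ipP)// -sqrtr_sqr ler_wsqrtr//.
have := ip_ge0 ipP y; rewrite le_eqVlt => /predU1P[y0|y0].
  have [->|xy0] := eqVneq (ip x y) 0; first by rewrite expr0n/= mulr_ge0 ?(ip_ge0 ipP).
  (* A nonconstant affine function of a takes negative values. *)
  have := sq (- (ip x x + 1) / (2 * ip x y)); rewrite -y0 mulr0 addr0.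
  have -> : 2 * (- (ip x x + 1) / (2 * ip x y)) * ip x y = - (ip x x + 1) by field.
  by lra.
(* The minimizer of the quadratic polynomial in a. *)
have := sq (- ip x y / ip y y).
have -> : ip x x + 2 * (- ip x y / ip y y) * ip x y + (- ip x y / ip y y) ^+ 2 * ip y y =
  (ip x x * ip y y - ip x y ^+ 2) / ip y y by field; rewrite gt_eqF.
by rewrite pmulr_lge0 ?invr_gt0// subr_ge0.
Qed.

Lemma ler_ip x y (a b : R) : N x <= a -> N y <= b -> `|ip x y| <= a * b.
Proof.
move=> xa yb; apply: le_trans (ip_CauchySchwarz x y) _.
by apply: ler_pM => //; exact: ipnorm_ge0.
Qed.

Lemma ipnormD x y : N (x + y) <= N x + N y.
Proof.
rewrite -(@ler_pXn2r _ 2) ?nnegrE ?addr_ge0 ?ipnorm_ge0//.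
rewrite sqrrD !sqr_ipnorm ipDl !ipDr (ipC ipP y x).
have := ip_CauchySchwarz x y; have := ler_norm (ip x y).
rewrite mulr2n; lra.
Qed.

Lemma ipnormZ a x : N (a *: x) = `|a| * N x.
Proof.
by rewrite /ipnorm ipZl ipZr mulrA -expr2 sqrtrM ?sqr_ge0// sqrtr_sqr.
Qed.

Lemma ipnormN x : N (- x) = N x.
Proof. by rewrite -scaleN1r ipnormZ normrN1 mul1r. Qed.

Lemma ipnormC x y : N (x - y) = N (y - x).
Proof. by rewrite -ipnormN opprB. Qed.

Lemma ipnorm0 : N 0 = 0.
Proof. by rewrite /ipnorm ip0l sqrtr0. Qed.

Section Convergence.
Context {I : Type} {F : set_system I} {FF : Filter F}.
Implicit Types (f g : I -> E) (l m : E).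

Definition ncvg f l := N (f i - l) @[i --> F] --> (0 : R).

Lemma ncvg_squeeze f l (h : I -> R) :
  (\forall i \near F, N (f i - l) <= h i) -> h i @[i --> F] --> (0 : R) -> ncvg f l.
Proof.
move=> fh h0; apply: (squeeze_cvgr _ (cvg_cst 0) h0).
by apply: filterS fh => i ->; rewrite ipnorm_ge0.
Qed.

Lemma ncvg_cst l : ncvg (fun=> l) l.
Proof. by rewrite /ncvg subrr ipnorm0; exact: cvg_cst. Qed.

Lemma ncvgD f g l m : ncvg f l -> ncvg g m -> ncvg (fun i => f i + g i) (l + m).
Proof.
move=> fl gm; apply: (ncvg_squeeze (h := fun i => N (f i - l) + N (g i - m))).
  by apply: nearW => i; rewrite opprD addrACA ipnormD.
by rewrite -(addr0 0); exact: cvgD.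
Qed.

Lemma ncvgZ (c : I -> R) a f l : c i @[i --> F] --> a -> ncvg f l ->
  ncvg (fun i => c i *: f i) (a *: l).
Proof.
move=> ca fl.
apply: (ncvg_squeeze (h := fun i => `|c i| * N (f i - l) + `|c i - a| * N l)).
  apply: nearW => i; rewrite -!ipnormZ.
  have -> : c i *: f i - a *: l = c i *: (f i - l) + (c i - a) *: l.
    by rewrite scalerBr scalerBl addrA subrK.
  exact: ipnormD.
have -> : 0 = `|a| * 0 + 0 * N l :> R by rewrite mulr0 mul0r addr0.
apply: cvgD; apply: cvgM => //; first exact: cvg_norm; last exact: cvg_cst.
by rewrite -(normr0 R); apply: cvg_norm; apply/subr_cvg0.
Qed.

Lemma ncvgB f g l m : ncvg f l -> ncvg g m -> ncvg (fun i => f i - g i) (l - m).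
Proof.
move=> fl /(ncvgZ (cvg_cst (-1 : R))) gm; rewrite -scaleN1r.
have -> : (fun i => f i - g i) = (fun i => f i + (-1) *: g i).
  by apply/funext => i; rewrite scaleN1r.
exact: ncvgD.
Qed.

Lemma ncvg_ip f g l m : ncvg f l -> ncvg g m ->
  ip (f i) (g i) @[i --> F] --> ip l m.
Proof.
move=> fl gm; apply/subr_cvg0; apply: norm_cvg0.
pose h i := N (f i - l) * N (g i - m) + N (f i - l) * N m + N l * N (g i - m).
apply: (@squeeze_cvgr _ F _ _ (fun=> 0) h).
- apply: nearW => i; rewrite normr_ge0/=.
  have -> : ip (f i) (g i) - ip l m =
      ip (f i - l) (g i - m) + ip (f i - l) m + ip l (g i - m).
    by rewrite !ipBl !ipBr; lra.
  rewrite (le_trans (ler_normD _ _))// lerD ?ip_CauchySchwarz//.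
  by rewrite (le_trans (ler_normD _ _))// lerD ?ip_CauchySchwarz.
- exact: cvg_cst.
- have -> : 0 = 0 * 0 + 0 * N m + N l * 0 :> R by rewrite !mul0r mulr0 !addr0.
  by apply: cvgD; [apply: cvgD|]; apply: cvgM => //; exact: cvg_cst.
Qed.

(** The derivative of the squared norm along a curve f. With c the inverse time
    increment, the quotient is <f + l, c (f - l)>, which avoids a separate
    treatment of the quadratic remainder. *)
Lemma cvg_quotient_sqr (c : I -> R) f l l' :
  ncvg f l -> ncvg (fun i => c i *: (f i - l)) l' ->
  c i * (ip (f i) (f i) - ip l l) @[i --> F] --> 2 * ip l l'.
Proof.
move=> fl fl'.
have -> : (fun i => c i * (ip (f i) (f i) - ip l l)) =
    (fun i => ip (f i + l) (c i *: (f i - l))).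
  by apply/funext => i; rewrite ipZr -ip_sqrB.
have -> : 2 * ip l l' = ip (l + l) l' by rewrite ipDl; lra.
by apply: ncvg_ip => //; apply: ncvgD => //; exact: ncvg_cst.
Qed.

End Convergence.
End SemiInnerTheory.
Arguments ncvg {R E} ip {I} F f l.
Arguments ipnorm {R E} ip x.

(** * The energy identity for a curve in a semi-inner product space *)

Section Curve.
Context {R : realType} {E : lmodType R} {ip : E -> E -> R}.
Context (ipP : semi_inner ip) (alpha T : R) (u v : R -> E) (C1 C2 : R).
Local Notation N := (ipnorm ip).
Local Notation mu := (@lebesgue_measure R).
Context (alpha01 : 0 < alpha < 1) (T_gt0 : 0 < T).
Context (u_holder : forall s t : R, s \in `[0, T] -> t \in `[0, T] ->
  N (u t - u s) <= C1 * `|s - t| `^ alpha).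
Context (u_deriv : forall t : R, t \in `]0, T] ->
  ncvg ip (within `[0, T] t^') (fun s => (s - t)^-1 *: (u s - u t)) (v t)).
Context (v_cont : forall t : R, t \in `]0, T] ->
  ncvg ip (within `]0, T] (nbhs t)) v (v t)).
Context (v_bound : forall t : R, t \in `]0, T] -> N (v t) <= C2 * t `^ (alpha - 1)).
Implicit Types (s t r a b x : R) (w : E).

Let alpha_gt0 : 0 < alpha. Proof. by case/andP: alpha01. Qed.
Let alpha_lt1 : alpha < 1. Proof. by case/andP: alpha01. Qed.

Lemma u_ncvg t : t \in `[0, T] -> ncvg ip (within `[0, T] (nbhs t)) u (u t).
Proof.
move=> tT; apply: (ncvg_squeeze (h := fun s => `|C1| * `|s - t| `^ alpha)).
  change (nbhs t (fun s => `[0, T]%classic s ->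
    N (u s - u t) <= `|C1| * `|s - t| `^ alpha)).
  apply: (@filterE _ (nbhs t)) => s sT.
  rewrite distrC; apply: le_trans (u_holder tT sT) _.
  by rewrite ler_wpM2r ?powR_ge0// ler_norm.
have h : `|C1| * `|s - t| `^ alpha @[s --> t] --> `|C1| * 0.
  by apply: cvgM; [exact: cvg_cst|apply: norm_powR_cvg0; case/andP: alpha01].
by rewrite mulr0 in h; exact: cvg_within_filter h.
Qed.

Lemma C2_ge0 : 0 <= C2.
Proof.
have TT : T \in `]0, T] by rewrite in_itv/= T_gt0 lexx.
by have := le_trans (ipnorm_ge0 _) (v_bound TT); rewrite pmulr_lge0 // powR_gt0.
Qed.

Lemma itv_oo_nbhs t : 0 < t < T -> nbhs t `]0, T[%classic.
Proof.
by move=> tT; apply: near_in_itvoo; rewrite in_itv.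
Qed.

Lemma u_deriv_interior t : 0 < t < T ->
  ncvg ip t^' (fun s => (s - t)^-1 *: (u s - u t)) (v t).
Proof.
move=> /[dup] tT /andP[t0 t1].
have tT' : t \in `]0, T] by rewrite in_itv/= t0 ltW.
apply: cvg_trans (u_deriv tT'); apply: cvg_app.
move=> P [e /= e0 eP]; apply: filterS2 (itv_oo_nbhs tT) (nbhsx_ballx t _ e0) => s.
move=> /= sT se st; apply: eP => //=; exact: subset_itv_oo_cc sT.
Qed.

Lemma u_cont_interior t : 0 < t < T -> ncvg ip (nbhs t) u (u t).
Proof.
move=> /[dup] tT /andP[t0 t1].
have tT' : t \in `[0, T] by rewrite in_itv/= !ltW.
apply: cvg_trans (u_ncvg tT'); apply: cvg_app.
move=> P [e /= e0 eP]; apply: filterS2 (itv_oo_nbhs tT) (nbhsx_ballx t _ e0) => s.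
by move=> /= sT se; apply: eP => //=; exact: subset_itv_oo_cc sT.
Qed.

Lemma v_cont_interior t : 0 < t < T -> ncvg ip (nbhs t) v (v t).
Proof.
move=> /[dup] tT /andP[t0 t1].
have tT' : t \in `]0, T] by rewrite in_itv/= t0 ltW.
apply: cvg_trans (v_cont tT'); apply: cvg_app.
move=> P [e /= e0 eP]; apply: filterS2 (itv_oo_nbhs tT) (nbhsx_ballx t _ e0) => s.
by move=> /= sT se; apply: eP => //=; exact: subset_itv_oo_oc sT.
Qed.

Lemma is_derive_ip w t : 0 < t < T ->
  is_derive t 1 (fun s => ip (u s) w) (ip (v t) w).
Proof.
move=> tT; apply: is_derive_dnbhs.
have -> : (fun s => (s - t)^-1 * (ip (u s) w - ip (u t) w)) =
    (fun s => ip ((s - t)^-1 *: (u s - u t)) w).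
  by apply/funext => s; rewrite (ipZl ipP) (ipBl ipP).
by apply: (ncvg_ip ipP) (u_deriv_interior tT) _; exact: ncvg_cst.
Qed.

(** The scalar mean value theorem applied to the pairing of u with
    w = u b - u a, whose increment over [a, b] is the square of N w. *)
Lemma u_lipschitz_le a b : 0 < a -> a <= b -> b <= T ->
  N (u b - u a) <= C2 * a `^ (alpha - 1) * (b - a).
Proof.
move=> a0 ab bT; set w := u b - u a.
have inT x : x \in `[a, b] -> x \in `]0, T].
  by rewrite !in_itv/= => /andP[ax xb]; rewrite (lt_le_trans a0 ax) (le_trans xb).
have inT0 x : x \in `[a, b] -> x \in `[0, T].
  by move=> /inT; exact: subset_itv_oc_cc.
have [||c cab] := @MVT_segment R (fun s => ip (u s) w) (fun s => ip (v s) w) a b ab.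
- move=> x; rewrite in_itv/= => /andP[ax xb]; apply: is_derive_ip.
  by rewrite (lt_trans a0 ax) (lt_le_trans xb).
- apply/subspace_continuousP => x /= xab; have xT := inT0 _ xab.
  apply: (cvg_trans (G := (fun s => ip (u s) w) @ within `[0, T] (nbhs x))).
    apply: cvg_app => P [e /= e0 eP]; exists e => //= s xs sab.
    by apply: eP => //; exact: inT0.
  by apply: (ncvg_ip ipP) (u_ncvg xT) _; exact: ncvg_cst.
rewrite -(ipBl ipP) -/w -(sqr_ipnorm ipP) => wE.
have cT := inT _ cab; move: cab; rewrite in_itv/= => /andP[ac cb].
have ba : 0 <= b - a by rewrite subr_ge0.
have M0 : 0 <= C2 * a `^ (alpha - 1) by rewrite mulr_ge0 ?powR_ge0 ?C2_ge0.
have vc : N (v c) <= C2 * a `^ (alpha - 1).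
  apply: le_trans (v_bound cT) _; rewrite ler_wpM2l ?C2_ge0//.
  by rewrite -opprB ler_powR_neg ?a0//= subr_ge0 ltW.
have [w0|w0] := eqVneq (N w) 0; first by rewrite w0 mulr_ge0.
have wgt : 0 < N w by rewrite lt_def w0 ipnorm_ge0.
rewrite -(ler_pM2r wgt) -expr2 wE.
rewrite mulrAC ler_wpM2r//; apply: le_trans (ler_norm _) _.
exact: ler_ip.
Qed.

Lemma u_lipschitz a s t : 0 < a -> a <= s <= T -> a <= t <= T ->
  N (u s - u t) <= C2 * a `^ (alpha - 1) * `|s - t|.
Proof.
move=> a0 sT tT; wlog ts : s t sT tT / t <= s.
  by case/orP: (le_total t s) => ts h; [exact: h|rewrite (ipnormC ipP) distrC; exact: h].
have /andP[as_ sT'] := sT; have /andP[at_ tT'] := tT.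
apply: (le_trans (u_lipschitz_le (lt_le_trans a0 at_) ts sT')).
rewrite ger0_norm ?subr_ge0// ler_wpM2r ?subr_ge0// ler_wpM2l ?C2_ge0//.
by rewrite -opprB ler_powR_neg ?a0//= subr_ge0 ltW.
Qed.

Lemma integrable_le_beta (f : R -> R) (M : R) : {in `]0, 1[, continuous f} ->
  (forall r, 0 < r < 1 -> `|f r| <= M * beta_kernel alpha r) ->
  mu.-integrable `]0, 1[ (EFin \o f).
Proof.
move=> cf fM; apply: (le_integrable_itv (g := fun r => M * beta_kernel alpha r)) => //.
rewrite (_ : _ \o _ = (fun r => M%:E * (EFin \o beta_kernel alpha) r)%E)//.
by apply: integrableZl => //; exact: integrable_beta_kernel.
Qed.

(** The increment u s - u tau at the time tau = s r. *)
Definition chord s r : E := u s - u (s * r).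

Let in_cc s : 0 < s <= T -> s \in `[0, T].
Proof. by rewrite in_itv/= => /andP[/ltW -> ->]. Qed.

Let scale_in s r : 0 < s <= T -> 0 < r < 1 -> 0 < s * r < T.
Proof.
move=> /andP[s0 sT] /andP[r0 r1]; rewrite mulr_gt0//=.
by apply: lt_le_trans sT; rewrite gtr_pMr.
Qed.

(** Near r = 1 this is the Lipschitz bound on [a / 2, T]; for r < 1/2, where v
    is too singular, the Hoelder bound suffices because 1 - r is bounded below. *)
Lemma chord_le a : 0 < a -> exists2 K : R, 0 <= K &
  forall s r, a <= s <= T -> 0 < r < 1 -> N (chord s r) <= K * (1 - r).
Proof.
move=> a0; exists (C2 * (a / 2) `^ (alpha - 1) * T + `|C1| * T `^ alpha * 2).
  by rewrite addr_ge0// !mulr_ge0 ?C2_ge0 ?powR_ge0// ltW.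
move=> s r /andP[as_ sT] r01; have /andP[r0 r1] := r01.
have s0 : 0 < s := lt_le_trans a0 as_.
have sT' : 0 < s <= T by rewrite s0.
have /andP[sr0 srT] := scale_in sT' r01.
have p1 : 0 <= C2 * (a / 2) `^ (alpha - 1) * T.
  by rewrite !mulr_ge0 ?C2_ge0 ?powR_ge0// ltW.
have p2 : 0 <= `|C1| * T `^ alpha * 2 by rewrite !mulr_ge0 ?powR_ge0.
have y0 : 0 < 1 - r by rewrite subr_gt0.
have [rh|rh] := leP 2^-1 r.
  have a2 : 0 < a / 2 by lra.
  have h1 : a / 2 <= s <= T by rewrite sT andbT; lra.
  have h2 : a / 2 <= s * r <= T.
    by rewrite (ltW srT) andbT ler_pM//; lra.
  apply: (le_trans (u_lipschitz a2 h1 h2)).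
  rewrite mulrDl -[leLHS]addr0 lerD ?mulr_ge0 ?powR_ge0 ?(ltW y0)//.
  rewrite -[leRHS]mulrA ler_wpM2l ?mulr_ge0 ?C2_ge0 ?powR_ge0//.
  rewrite -[X in X - _]mulr1 -mulrBr normrM !ger0_norm ?(ltW y0) ?(ltW s0)//.
  by rewrite ler_wpM2r// ltW.
have sr_in : s * r \in `[0, T] by rewrite in_itv/= !ltW.
apply: (le_trans (u_holder sr_in (in_cc sT'))).
apply: (@le_trans _ _ (`|C1| * T `^ alpha)).
  apply: (@le_trans _ _ (`|C1| * `|s * r - s| `^ alpha)).
    by rewrite ler_wpM2r ?powR_ge0// ler_norm.
  rewrite ler_wpM2l// ge0_ler_powR ?nnegrE ?(ltW alpha_gt0) ?(ltW T_gt0)//.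
  have : s * r <= s by rewrite ger_pMr// ltW.
  rewrite ler_norml; move: (ltW sr0) => *; apply/andP; split; lra.
rewrite mulrDl; have : 0 <= C2 * (a / 2) `^ (alpha - 1) * T * (1 - r) by rewrite mulr_ge0// ltW.
have : 0 <= `|C1| * T `^ alpha by rewrite mulr_ge0 ?powR_ge0.
nra.
Qed.

(** The singularity of v at time 0 enters through the factor r^(alpha-1), to the
    first power only: the other factor of a difference of squared chords is
    bounded by chord_le. The square of this factor would not be integrable for
    alpha at most 1/2. *)
Lemma chord_lipschitz a s t r : 0 < a -> a <= s <= T -> a <= t <= T -> 0 < r < 1 ->
  N (chord s r - chord t r) <=
    2 * C2 * a `^ (alpha - 1) * r `^ (alpha - 1) * `|s - t|.
Proof.
move=> a0 sT tT r01; have /andP[r0 r1] := r01.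
have pos x : a <= x <= T -> 0 < x <= T.
  by case/andP=> ax ->; rewrite (lt_le_trans a0 ax).
have scaled x : a <= x <= T -> a * r <= x * r <= T.
  move=> /[dup] /andP[ax _] /pos xT; have /andP[_ /ltW ->] := scale_in xT r01.
  by rewrite andbT ler_wpM2r// ltW.
have ar0 : 0 < a * r by rewrite mulr_gt0.
have -> : chord s r - chord t r = (u s - u t) - (u (s * r) - u (t * r)).
  by rewrite /chord !opprB addrACA [RHS]addrACA; congr (_ + _); rewrite addrC.
apply: (le_trans (ipnormD ipP _ _)); rewrite (ipnormN ipP).
have h1 := u_lipschitz a0 sT tT.
have h2 := u_lipschitz ar0 (scaled _ sT) (scaled _ tT).
rewrite powRM ?(ltW a0) ?(ltW r0)// -mulrBl normrM (gtr0_norm r0) in h2.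
have k1 : 1 <= r `^ (alpha - 1).
  by rewrite -[leLHS](powRr0 r) ger_powR ?r0 ?(ltW r1)//= subr_le0 ltW.
set c := C2 * a `^ (alpha - 1) * `|s - t|.
have c0 : 0 <= c by rewrite !mulr_ge0 ?C2_ge0 ?powR_ge0.
have h1' : N (u s - u t) <= c * r `^ (alpha - 1).
  by apply: le_trans h1 _; rewrite -[leLHS]mulr1 ler_wpM2l.
have h2' : N (u (s * r) - u (t * r)) <= c * r `^ (alpha - 1).
  apply: le_trans h2 _.
  rewrite (_ : _ * _ = c * r `^ (alpha - 1) * r); last by rewrite /c; ring.
  by rewrite ler_piMr ?(ltW r1)// mulr_ge0 ?powR_ge0.
apply: le_trans (lerD h1' h2') _; rewrite /c; lra.
Qed.

Let scale_cvg c x : c * y @[y --> x] --> c * x.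
Proof. by apply: cvgM; [exact: cvg_cst|exact: cvg_id]. Qed.

Let scale_cvg_dnbhs c x : c != 0 -> c * y @[y --> x^'] --> (c * x)^'.
Proof.
move=> c0 P cP.
have cP' : nbhs x (fun y => c * y != c * x -> P (c * y)) := @scale_cvg c x _ cP.
change (nbhs x (fun y => y != x -> P (c * y))).
apply: filterS cP' => y h yx; apply: h.
by rewrite -subr_eq0 -mulrBr mulf_neq0// subr_eq0.
Qed.

Lemma chord_ncvg s r : 0 < s <= T -> 0 < r < 1 -> ncvg ip (nbhs r) (chord s) (chord s r).
Proof.
move=> sT r01; apply: ncvgB => //; first exact: ncvg_cst.
exact: (cvg_comp _ _ (@scale_cvg s r) (u_cont_interior (scale_in sT r01))).
Qed.

Lemma v_scale_ncvg s r : 0 < s <= T -> 0 < r < 1 ->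
  ncvg ip (nbhs r) (fun x => v (s * x)) (v (s * r)).
Proof.
move=> sT r01.
exact: (cvg_comp _ _ (@scale_cvg s r) (v_cont_interior (scale_in sT r01))).
Qed.

Lemma u_scale_deriv c x : 0 < c -> 0 < c * x < T ->
  ncvg ip x^' (fun y => (y - x)^-1 *: (u (c * y) - u (c * x))) (c *: v (c * x)).
Proof.
move=> c0 cx.
have -> : (fun y => (y - x)^-1 *: (u (c * y) - u (c * x))) =
    (fun y => c *: ((c * y - c * x)^-1 *: (u (c * y) - u (c * x)))).
  apply/funext => y; rewrite scalerA -mulrBr invfM mulrA divff ?gt_eqF// mul1r//.
apply: ncvgZ => //; first exact: cvg_cst.
exact: (cvg_comp _ _ (@scale_cvg_dnbhs c x (lt0r_neq0 c0)) (u_deriv_interior cx)).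
Qed.

Local Notation chord2 s r := (ip (chord s r) (chord s r)).

(** The memory integral of the functional D_alpha, rescaled to ]0, 1[. *)
Definition history s : R :=
  \int[mu]_(r in `]0, 1[) (chord2 s r * (1 - r) `^ (- (alpha + 1))).

(** The derivative in the time variable of the integrand of history. *)
Definition history_rate t r : R :=
  2 * ip (chord t r) (v t - r *: v (t * r)) * (1 - r) `^ (- (alpha + 1)).

Lemma chord2_continuous s : 0 < s <= T ->
  {in `]0, 1[, continuous (fun r => chord2 s r)}.
Proof.
move=> sT r; rewrite in_itv/= => r01.
by apply: (ncvg_ip ipP); exact: chord_ncvg.
Qed.

Let weight_continuous (p : R) : {in `]0, 1[, continuous (fun r => (1 - r) `^ p)}.
Proof. by move=> r; rewrite in_itv/= => /andP[_ r1]; exact: powR_onem_continuous. Qed.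

Lemma history_continuous s (p : R) : 0 < s <= T ->
  {in `]0, 1[, continuous (fun r => chord2 s r * (1 - r) `^ p)}.
Proof.
move=> sT r r01; apply: cvgM; first exact: chord2_continuous.
exact: weight_continuous.
Qed.

Lemma history_rate_continuous t : 0 < t <= T ->
  {in `]0, 1[, continuous (history_rate t)}.
Proof.
move=> tT r r01; apply: cvgM; last exact: weight_continuous.
apply: cvgM; first exact: cvg_cst.
move: r01; rewrite in_itv/= => r01.
apply: (ncvg_ip ipP); first exact: chord_ncvg.
apply: (ncvgB ipP); first exact: ncvg_cst.
by apply: (ncvgZ ipP); [exact: cvg_id|exact: v_scale_ncvg].
Qed.

Lemma chord2_le a : 0 < a -> exists2 K : R, 0 <= K &
  forall s r, a <= s <= T -> 0 < r < 1 -> chord2 s r <= K * (1 - r) ^+ 2.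
Proof.
move=> a0; have [K K0 Kle] := chord_le a0; exists (K ^+ 2); first exact: sqr_ge0.
move=> s r sT r01; rewrite -(sqr_ipnorm ipP) -exprMn ler_pXn2r// ?nnegrE ?ipnorm_ge0 ?Kle//.
by rewrite mulr_ge0// subr_ge0; case/andP: r01 => _ /ltW.
Qed.

Lemma chord2_integrable s : 0 < s <= T ->
  mu.-integrable `]0, 1[ (EFin \o (fun r => chord2 s r * (1 - r) `^ (- (alpha + 1)))) /\
  mu.-integrable `]0, 1[ (EFin \o (fun r => chord2 s r * (1 - r) `^ (- (alpha + 1 + 1)))).
Proof.
move=> sT; have /andP[s0 s1] := sT; have [K K0 Kle] := chord2_le s0.
have bnd r : 0 < r < 1 -> [/\ 0 < 1 - r, 1 - r <= 1,
    chord2 s r <= K * (1 - r) ^+ 2 & 0 <= (1 - r) `^ (- alpha) <= beta_kernel alpha r].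
  move=> r01; split; [by lra|by lra|by rewrite Kle// lexx|].
  by rewrite powR_ge0 beta_kernel_ge.
have pos r : 0 <= chord2 s r := ip_ge0 ipP _.
split; apply: (integrable_le_beta (M := K)); try exact: history_continuous.
- move=> r /bnd[y0 y1 h /andP[X0 Xb]]; rewrite powR_oppS// ger0_norm; last first.
    by rewrite mulr_ge0// divr_ge0// ltW.
  apply: (@le_trans _ _ (K * (1 - r) `^ (- alpha))); last by rewrite ler_wpM2l.
  rewrite mulrA ler_pdivrMr//; apply: (le_trans (ler_wpM2r X0 h)).
  have : 0 <= K * (1 - r) `^ (- alpha) * (1 - r) by rewrite !mulr_ge0// ltW.
  by move=> ?; nra.
- move=> r /bnd[y0 y1 h /andP[X0 Xb]]; rewrite !powR_oppS// ger0_norm; last first.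
    by rewrite mulr_ge0// !divr_ge0// ltW.
  apply: (@le_trans _ _ (K * (1 - r) `^ (- alpha))); last by rewrite ler_wpM2l.
  rewrite !mulrA !ler_pdivrMr//; apply: (le_trans (ler_wpM2r X0 h)).
  by rewrite expr2; lra.
Qed.

Lemma history_rate_integrable t : 0 < t <= T ->
  mu.-integrable `]0, 1[ (EFin \o history_rate t).
Proof.
move=> tT; have /andP[t0 t1] := tT; have [K K0 Kle] := chord_le t0.
pose c := C2 * t `^ (alpha - 1).
have c0 : 0 <= c by rewrite mulr_ge0 ?C2_ge0 ?powR_ge0.
apply: (integrable_le_beta (M := 4 * K * c)); first exact: history_rate_continuous.
move=> r r01; have /andP[r0 r1] := r01; have y0 : 0 < 1 - r by rewrite subr_gt0.
have k1 : 1 <= r `^ (alpha - 1).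
  by rewrite -[leLHS](powRr0 r) ger_powR ?r0 ?(ltW r1)//= subr_le0 ltW.
have vt : N (v t - r *: v (t * r)) <= 2 * c * r `^ (alpha - 1).
  apply: (le_trans (ipnormD ipP _ _)); rewrite (ipnormN ipP) (ipnormZ ipP) (gtr0_norm r0).
  have h1 : N (v t) <= c by apply: v_bound; rewrite in_itv.
  have h2 : N (v (t * r)) <= c * r `^ (alpha - 1).
    rewrite /c -mulrA -powRM ?(ltW t0) ?(ltW r0)//; apply: v_bound.
    by have /andP[? ?] := scale_in tT r01; rewrite in_itv/=; apply/andP; split; lra.
  have := ipnorm_ge0 (ip := ip) (v (t * r)); nra.
rewrite /history_rate !normrM normr_nat (ger0_norm (powR_ge0 _ _)) powR_oppS//.
have := ler_ip ipP (Kle t r _ r01) vt; rewrite lexx t1 => /(_ isT) h.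
rewrite /beta_kernel; set X := (1 - r) `^ (- alpha).
have X0 : 0 <= X by exact: powR_ge0.
rewrite [leLHS]mulrA ler_pdivrMr//.
have := ler_wpM2r X0 h; set Y := r `^ (alpha - 1); lra.
Qed.

(** Differentiation under the integral, on the times of [t / 2, T] to keep away
    from the singularity of v at 0; the limit is one-sided when t = T. *)
Lemma history_derive t : 0 < t <= T ->
  (s - t)^-1 * (history s - history t) @[s --> within `[0, T] t^'] -->
    \int[mu]_(r in `]0, 1[) history_rate t r.
Proof.
move=> tT; have /andP[t0 t1] := tT.
pose w r := (1 - r) `^ (- (alpha + 1)).
pose h s r := (s - t)^-1 * (chord2 s r * w r - chord2 t r * w r).
pose B : set R := `[t / 2, T]%classic.
have t2 : 0 < t / 2 by lra.
have B0 s : B s -> 0 < s <= T.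
  by rewrite /B/= in_itv/= => /andP[ts ->]; rewrite (lt_le_trans t2 ts).
have Bt : t / 2 <= t <= T by rewrite t1 andbT; lra.
have BT : within B t^' --> within `[0, T] t^'.
  apply: (within_dnbhs_local (W := setT)); first exact: filterT.
  by move=> s [/B0 sT _]; exact: in_cc.
have TB : within `[0, T] t^' --> within B t^'.
  apply: (within_dnbhs_local (W := `]t / 2, +oo[%classic)).
    by apply: open_nbhs_nbhs; split; [exact: interval_open|rewrite /= in_itv/= andbT; lra].
  by move=> s []; rewrite /B/= !in_itv/= andbT => /andP[_ ->] /ltW ->.
have hE s : B s -> (s - t)^-1 * (history s - history t) = \int[mu]_(r in `]0, 1[) h s r.
  move=> /B0 sT; have [is_ _] := chord2_integrable sT; have [it _] := chord2_integrable tT.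
  rewrite /h RintegralZl//; last first.
    exact: (integrableB _ is_ it).
  by rewrite RintegralB.
have [K K0 Kle] := chord_le t2.
pose L := 2 * C2 * (t / 2) `^ (alpha - 1).
have hle s r : B s -> s != t -> `]0, 1[%classic r -> `|h s r| <= 2 * K * L * beta_kernel alpha r.
  move=> Bs st; rewrite /= in_itv/= => r01; have sT := B0 _ Bs.
  have /andP[r0 r1] := r01; have y0 : 0 < 1 - r by rewrite subr_gt0.
  have sB : t / 2 <= s <= T by move: Bs; rewrite /B/= in_itv.
  have diff : chord2 s r - chord2 t r = ip (chord s r + chord t r) (chord s r - chord t r).
    exact: ip_sqrB.
  have sum : N (chord s r + chord t r) <= 2 * K * (1 - r).
    apply: (le_trans (ipnormD ipP _ _)); have := Kle _ _ sB r01; have := Kle _ _ Bt r01; lra.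
  have st0 : 0 < `|s - t| by rewrite normr_gt0 subr_eq0.
  have := ler_ip ipP sum (chord_lipschitz t2 sB Bt r01).
  rewrite -diff /h -mulrBl !normrM normfV (ger0_norm (powR_ge0 _ _)) /w powR_oppS// -/L.
  rewrite /beta_kernel; set X := (1 - r) `^ (- alpha); set Y := r `^ (alpha - 1) => le.
  have X0 : 0 <= X by exact: powR_ge0.
  rewrite ler_pdivrMl// [leLHS]mulrA ler_pdivrMr//.
  have := ler_wpM2r X0 le; lra.
have hcvg r : `]0, 1[%classic r -> h s r @[s --> within B t^'] --> history_rate t r.
  rewrite /= in_itv/= => r01; have /andP[r0 r1] := r01.
  have -> : (fun s => h s r) = (fun s => (s - t)^-1 * (chord2 s r - chord2 t r) * w r).
    by apply/funext => s; rewrite /h -mulrBl mulrA.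
  apply: cvgM; last exact: cvg_cst.
  apply: (cvg_quotient_sqr ipP).
    apply: (ncvg_squeeze (h := fun s => L * r `^ (alpha - 1) * `|s - t|)).
      change (nbhs t (fun s => s != t -> B s -> N (chord s r - chord t r) <=
        L * r `^ (alpha - 1) * `|s - t|)).
      apply: (@filterE _ (nbhs t)) => s _; rewrite /B/= in_itv/= => sB.
      exact: chord_lipschitz.
    rewrite -(mulr0 (L * r `^ (alpha - 1))); apply: cvgM; first exact: cvg_cst.
    rewrite -(normr0 R); apply: cvg_norm; rewrite -(subrr t); apply: cvgB; last exact: cvg_cst.
    exact: within_dnbhs_nbhs.
  have -> : (fun s => (s - t)^-1 *: (chord s r - chord t r)) =
     (fun s => (s - t)^-1 *: (u s - u t) - (s - t)^-1 *: (u (r * s) - u (r * t))).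
    apply/funext => s; rewrite -scalerBr /chord ![r * _]mulrC !opprB addrACA [in RHS]addrACA.
    by congr (_ *: (_ + _)); rewrite addrC.
  apply: (ncvgB ipP).
    by apply: cvg_trans (cvg_app _ BT) (u_deriv _); rewrite in_itv.
  rewrite [t * r]mulrC.
  have rt : 0 < r * t < T by rewrite mulrC; exact: scale_in.
  apply: cvg_trans (cvg_app _ _) (u_scale_deriv r0 rt).
  exact: cvg_within.
apply: (cvg_trans _ (dominated_cvg_within (B := `]0, 1[) (A := B) (h := h) (l := history_rate t)
  (e := fun r => 2 * K * L * beta_kernel alpha r) _ _ _ _ _ _)) => //.
- apply: cvg_trans (cvg_app _ TB) _.
  apply: near_eq_cvg; change (nbhs t (fun s => s != t -> B s ->
    \int[mu]_(r in `]0, 1[) h s r = (s - t)^-1 * (history s - history t))).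
  by apply: (@filterE _ (nbhs t)) => s _ Bs; rewrite hE.
- move=> s /B0 sT _; apply: measurable_funM; first exact: measurable_cst.
  by apply: measurable_funB; apply: continuous_itv_measurable; exact: history_continuous.
- by apply: continuous_itv_measurable; exact: history_rate_continuous.
- exact: hcvg.
- rewrite (_ : _ \o _ = (fun r => (2 * K * L)%:E * (EFin \o beta_kernel alpha) r)%E)//.
  by apply: integrableZl => //; exact: integrable_beta_kernel.
- exact: hle.
Qed.

Lemma caputo_integrable t w : 0 < t <= T ->
  {in `]0, 1[, continuous (fun r => ip (v (t * r)) w * (1 - r) `^ (- alpha))} /\
  mu.-integrable `]0, 1[ (EFin \o (fun r => ip (v (t * r)) w * (1 - r) `^ (- alpha))).
Proof.
move=> tT; have /andP[t0 t1] := tT.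
have cf : {in `]0, 1[, continuous (fun r => ip (v (t * r)) w * (1 - r) `^ (- alpha))}.
  move=> r r01; apply: cvgM; last exact: weight_continuous.
  by apply: (ncvg_ip ipP) (ncvg_cst ipP _); apply: v_scale_ncvg => //; rewrite in_itv in r01.
split=> //; apply: (integrable_le_beta (M := C2 * t `^ (alpha - 1) * N w)) => // r r01.
have /andP[r0 r1] := r01; have /andP[tr0 trT] := scale_in tT r01.
have vb : N (v (t * r)) <= C2 * t `^ (alpha - 1) * r `^ (alpha - 1).
  rewrite -mulrA -powRM ?(ltW t0) ?(ltW r0)//; apply: v_bound.
  by rewrite in_itv/= tr0 ltW.
rewrite normrM (ger0_norm (powR_ge0 _ _)) /beta_kernel mulrA ler_wpM2r ?powR_ge0//.
have := ler_ip ipP vb (lexx (N w)); lra.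
Qed.

Lemma chord_deriv t r : 0 < t <= T -> 0 < r < 1 ->
  ncvg ip r^' (fun y => (y - r)^-1 *: (chord t y - chord t r)) (- (t *: v (t * r))).
Proof.
move=> tT r01; have /andP[t0 t1] := tT.
rewrite -[X in ncvg _ _ _ X]sub0r.
rewrite [X in ncvg _ _ X _](_ : _ =
    (fun y => 0 - (y - r)^-1 *: (u (t * y) - u (t * r)))); last first.
  apply/funext => y.
  have -> : chord t y - chord t r = - (u (t * y) - u (t * r)).
    by rewrite /chord !opprB [LHS]addrC addrA subrK.
  by rewrite scalerN sub0r.
apply: (ncvgB ipP); first exact: ncvg_cst.
by apply: u_scale_deriv => //; exact: scale_in.
Qed.

Lemma is_derive_ip_chord t w r : 0 < t <= T -> 0 < r < 1 ->
  is_derive r 1 (fun y => ip (chord t y) w) (- t * ip (v (t * r)) w).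
Proof.
move=> tT r01; apply: is_derive_dnbhs.
have -> : (fun y => (y - r)^-1 * (ip (chord t y) w - ip (chord t r) w)) =
    (fun y => ip ((y - r)^-1 *: (chord t y - chord t r)) w).
  by apply/funext => y; rewrite (ipZl ipP) (ipBl ipP (chord t y) (chord t r)).
have -> : - t * ip (v (t * r)) w = ip (- (t *: v (t * r))) w.
  by rewrite (ipNl ipP) (ipZl ipP) mulNr.
by apply: (ncvg_ip ipP); [exact: chord_deriv|exact: ncvg_cst].
Qed.

Lemma is_derive_chord2 t r : 0 < t <= T -> 0 < r < 1 ->
  is_derive r 1 (fun y => chord2 t y) (- (2 * t) * ip (chord t r) (v (t * r))).
Proof.
move=> tT r01; apply: is_derive_dnbhs.
have -> : - (2 * t) * ip (chord t r) (v (t * r)) = 2 * ip (chord t r) (- (t *: v (t * r))).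
  rewrite (ipC ipP (chord t r) (- (t *: v (t * r)))) (ipNl ipP) (ipZl ipP).
  by rewrite (ipC ipP (v (t * r))); lra.
apply: (cvg_quotient_sqr ipP); last exact: chord_deriv.
apply: cvg_trans (cvg_app _ _) (chord_ncvg tT r01); exact: nbhs_dnbhs.
Qed.

(** The first term comes from integrating the Caputo pairing by parts. The
    second one is the boundary term that compensates the dilation tau = t r:
    it accounts for v (t r) in history_rate. *)
Definition parts_primitive t r : R :=
  - (ip (chord t r) (v t) * (1 - r) `^ (- alpha)) -
  alpha / (2 * t) * (r * (chord2 t r * (1 - r) `^ (- (alpha + 1)))).

Definition parts_derivative t r : R :=
  t * (ip (v (t * r)) (v t) * (1 - r) `^ (- alpha)) - alpha / 2 * history_rate t r +
  alpha ^+ 2 / (2 * t) * (chord2 t r * (1 - r) `^ (- (alpha + 1))) -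
  alpha * (alpha + 1) / (2 * t) * (chord2 t r * (1 - r) `^ (- (alpha + 1 + 1))).

Lemma is_derive_parts t r : 0 < t <= T -> 0 < r < 1 ->
  is_derive r 1 (parts_primitive t) (parts_derivative t r).
Proof.
move=> tT r01; have /andP[r0 r1] := r01; have /andP[t0 _] := tT.
have d1 := @is_deriveM R R^o _ _ _ _ _ _ (is_derive_ip_chord (v t) tT r01)
  (is_derive_powR_onem (- alpha) r1).
have d2 := @is_deriveM R R^o _ _ _ _ _ _ (is_derive_chord2 tT r01)
  (is_derive_powR_onem (- (alpha + 1)) r1).
have d3 := @is_deriveM R R^o _ _ _ _ _ _ (is_derive_id r (1 : R)) d2.
have d4 := @is_deriveZ R R^o R^o _ (alpha / (2 * t)) _ _ _ d3.
have d5 := @is_deriveB R R^o R^o _ _ _ _ _ _ (@is_deriveN R R^o R^o _ _ _ _ d1) d4.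
apply: (is_derive_eq d5).
have y0 : 1 - r != 0 by rewrite subr_eq0 gt_eqF.
rewrite /parts_derivative /history_rate (ipBr ipP) (ipZr ipP).
rewrite /GRing.scale/= mulrfctE -!opprD !powR_oppS ?subr_gt0//.
field.
by rewrite y0 gt_eqF.
Qed.

Lemma parts_primitive_at0 t : 0 < t <= T ->
  parts_primitive t r @[r --> 0^'+] --> - ip (u t - u 0) (v t).
Proof.
move=> tT; have /andP[t0 t1] := tT.
have c0 : ncvg ip 0^'+ (chord t) (chord t 0).
  apply: (ncvgB ipP); first exact: ncvg_cst.
  have tr0 : t * r @[r --> 0^'+] --> within `[0, T] (nbhs (t * 0)).
    move=> P [e /= e0 eP].
    have h : nbhs (0 : R) (fun r => ball (t * 0) e (t * r)).
      exact: (@scale_cvg t 0 (ball (t * 0) e) (nbhsx_ballx _ _ e0)).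
    change (nbhs (0 : R) (fun r => 0 < r -> P (t * r))).
    apply: filterS2 h (nbhsx_ballx 0 1 ltr01) => r /= he r1 r0; apply: eP => //=.
    move: r1; rewrite /ball/= sub0r normrN (gtr0_norm r0) => r1.
    rewrite in_itv/= mulr_ge0 ?(ltW t0) ?(ltW r0)//=; apply: le_trans t1.
    by rewrite ger_pMr// ltW.
  apply: (cvg_comp _ _ tr0 (@u_ncvg (t * 0) _)).
  by rewrite mulr0 in_itv/= lexx ltW.
have w0 (p : R) : (1 - r) `^ p @[r --> 0^'+] --> (1 : R).
  have h : (1 - r) `^ p @[r --> (0 : R)] --> (1 - 0) `^ p.
    exact: (@powR_onem_continuous R p 0 ltr01).
  rewrite subr0 powR1 in h.
  exact: cvg_at_right_filter h.
have -> : - ip (u t - u 0) (v t) = - (ip (chord t 0) (v t) * 1) -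
    alpha / (2 * t) * (0 * (chord2 t 0 * 1)).
  by rewrite mul0r mulr0 subr0 mulr1 /chord mulr0.
apply: cvgB.
  by apply: cvgN; apply: cvgM => //; apply: (ncvg_ip ipP) => //; exact: ncvg_cst.
apply: cvgM; first exact: cvg_cst.
apply: cvgM; first by apply: cvg_at_right_filter; exact: cvg_id.
by apply: cvgM => //; exact: (ncvg_ip ipP).
Qed.

(** The chord is O(1 - r), so both terms are O((1 - r)^(1-alpha)). *)
Lemma parts_primitive_at1 t : 0 < t <= T ->
  parts_primitive t r @[r --> 1^'-] --> (0 : R).
Proof.
move=> tT; have /andP[t0 t1] := tT.
have [K K0 Kle] := chord_le t0; have [L L0 Lle] := chord2_le t0.
have tt : t <= t <= T by rewrite lexx.
have vt0 := ipnorm_ge0 (ip := ip) (v t).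
pose M := K * N (v t) + alpha / (2 * t) * L.
have h0 : M * `|r - 1| `^ (1 - alpha) @[r --> 1^'-] --> M * 0.
  apply: cvgM; first exact: cvg_cst.
  by apply: cvg_at_left_filter; apply: norm_powR_cvg0; rewrite subr_gt0.
rewrite mulr0 in h0; apply: norm_cvg0; apply: (squeeze_cvgr _ (cvg_cst 0) h0).
change (nbhs (1 : R) (fun r => r < 1 ->
  0 <= `|parts_primitive t r| <= M * `|r - 1| `^ (1 - alpha))).
apply: filterS (nbhsx_ballx (1 : R) (1 : R) ltr01) => r rb r1; rewrite normr_ge0/=.
have r0 : 0 < r.
  by move: rb; rewrite /ball/= ger0_norm; lra.
have r01 : 0 < r < 1 by rewrite r0.
have y0 : 0 < 1 - r by rewrite subr_gt0.
have -> : `|r - 1| `^ (1 - alpha) = (1 - r) * (1 - r) `^ (- alpha).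
  rewrite distrC gtr0_norm// powRD; last by rewrite (gt_eqF y0) implybT.
  by rewrite powRr1// ltW.
rewrite /M /parts_primitive powR_oppS//; set b := alpha / (2 * t); set X := (1 - r) `^ (- alpha).
have X0 : 0 <= X by exact: powR_ge0.
apply: (le_trans (ler_normB _ _)).
have q1 := ler_ip ipP (Kle _ _ tt r01) (lexx (N (v t))).
have a2 : 0 <= b by rewrite divr_ge0 ?mulr_ge0// ltW.
clearbody b X; rewrite normrN normrM (ger0_norm X0) !normrM.
rewrite (ger0_norm (_ : 0 <= chord2 t r)) ?(ip_ge0 ipP)//.
rewrite (ger0_norm X0) (gtr0_norm r0) normfV (gtr0_norm y0) (ger0_norm a2).
have p1 := Lle _ _ tt r01.
rewrite mulrDl lerD//.
  have := ler_wpM2r X0 q1; lra.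
rewrite -[leRHS]mulrA ler_wpM2l//.
have p2 : r * (chord2 t r * (X / (1 - r))) <= chord2 t r * (X / (1 - r)).
  by rewrite ler_piMl ?(ltW r1)// mulr_ge0 ?(ip_ge0 ipP)// divr_ge0// ltW.
apply: (le_trans p2); rewrite mulrA ler_pdivrMr//.
have := ler_wpM2r X0 p1; rewrite expr2; lra.
Qed.

(** The improper fundamental theorem applied to parts_primitive, with the
    integral of its derivative split into four integrable pieces. *)
Lemma history_identity t : 0 < t <= T ->
  t * (\int[mu]_(r in `]0, 1[) (ip (v (t * r)) (v t) * (1 - r) `^ (- alpha))) =
  ip (u t - u 0) (v t) + alpha / 2 * (\int[mu]_(r in `]0, 1[) history_rate t r) -
  alpha ^+ 2 / (2 * t) * history t +
  alpha * (alpha + 1) / (2 * t) *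
    \int[mu]_(r in `]0, 1[) (chord2 t r * (1 - r) `^ (- (alpha + 1 + 1))).
Proof.
move=> tT.
have [c1 i1] := caputo_integrable (v t) tT.
have i2 := history_rate_integrable tT; have c2 := history_rate_continuous tT.
have [i3 i4] := chord2_integrable tT.
have c3 := history_continuous (p := - (alpha + 1)) tT.
have c4 := history_continuous (p := - (alpha + 1 + 1)) tT.
have cstc (c : R) (f : R -> R) : {in `]0, 1[, continuous f} ->
    {in `]0, 1[, continuous (fun r => c * f r)}.
  by move=> cf r r01; apply: cvgM; [exact: cvg_cst|exact: cf].
have csti (c : R) (f : R -> R) : mu.-integrable `]0, 1[ (EFin \o f) ->
    mu.-integrable `]0, 1[ (EFin \o (fun r => c * f r)).
  by move=> fi; exact: (integrableZl _ c fi).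
have ij1 := csti t _ i1; have ij2 := csti (alpha / 2) _ i2.
have ij3 := csti (alpha ^+ 2 / (2 * t)) _ i3.
have ij4 := csti (alpha * (alpha + 1) / (2 * t)) _ i4.
have subi (f g : R -> R) : mu.-integrable `]0, 1[ (EFin \o f) ->
    mu.-integrable `]0, 1[ (EFin \o g) ->
    mu.-integrable `]0, 1[ (EFin \o (fun r => f r - g r)).
  by move=> fi gi; exact: (integrableB _ fi gi).
have addi (f g : R -> R) : mu.-integrable `]0, 1[ (EFin \o f) ->
    mu.-integrable `]0, 1[ (EFin \o g) ->
    mu.-integrable `]0, 1[ (EFin \o (fun r => f r + g r)).
  by move=> fi gi; exact: (integrableD _ fi gi).
have ij12 := subi _ _ ij1 ij2; have ij123 := addi _ _ ij12 ij3.
have ij := subi _ _ ij123 ij4.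
have : \int[mu]_(r in `]0, 1[) parts_derivative t r = 0 - - ip (u t - u 0) (v t).
  apply: (improper_FTC2 ltr01 _ _ ij (parts_primitive_at0 tT) (parts_primitive_at1 tT)).
  - move=> r r01; apply: cvgB; last exact: cstc c4 _ r01.
    apply: cvgD; last exact: cstc c3 _ r01.
    by apply: cvgB; [exact: cstc c1 _ r01|exact: cstc c2 _ r01].
  - by move=> r; rewrite in_itv/= => r01; exact: is_derive_parts.
rewrite /parts_derivative RintegralB// RintegralD// RintegralB// !RintegralZl//.
by rewrite sub0r opprK => <-; rewrite /history; ring.
Qed.

Definition memory_functional (beta s : R) : R :=
  N (u s - u 0) ^+ 2 / (2 * s `^ beta) + beta / 2 *
  \int[mu]_(tau in `]0, s[) (N (u s - u tau) ^+ 2 / (s - tau) `^ (beta + 1)).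

Let interior_measurable s (f : R -> R) (p : R) : 0 < s <= T ->
  (forall tau, 0 < tau < T -> {for tau, continuous f}) ->
  measurable_fun `]0, s[ (fun tau => f tau * (s - tau) `^ p).
Proof.
move=> /andP[s0 sT] cf; apply: continuous_itv_measurable => x.
rewrite in_itv/= => /andP[x0 xs]; apply: cvgM.
  by apply: cf; rewrite x0 (lt_le_trans xs).
apply: (@continuous_comp _ _ _ (fun y : R => s - y) (@powR R ^~ p)).
  by apply: cvgB; [exact: cvg_cst|exact: cvg_id].
by apply: powR_continuous; rewrite subr_gt0.
Qed.

(** The substitution tau = s r, with q the order of the functional D_q. *)
Lemma memory_integral s (q : R) : 0 < s <= T ->
  mu.-integrable `]0, 1[ (EFin \o (fun r => chord2 s r * (1 - r) `^ (- (q + 1)))) ->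
  mu.-integrable `]0, s[
    (EFin \o (fun tau => N (u s - u tau) ^+ 2 / (s - tau) `^ (q + 1))) /\
  \int[mu]_(tau in `]0, s[) (N (u s - u tau) ^+ 2 / (s - tau) `^ (q + 1)) =
  s `^ (- q) * \int[mu]_(r in `]0, 1[) (chord2 s r * (1 - r) `^ (- (q + 1))).
Proof.
move=> sT i1; have /andP[s0 _] := sT.
have fE r : `]0, 1[%classic r -> N (u s - u (s * r)) ^+ 2 / (s - s * r) `^ (q + 1) =
    s `^ (- (q + 1)) * (chord2 s r * (1 - r) `^ (- (q + 1))).
  rewrite /= in_itv/= => /andP[r0 r1].
  rewrite (sqr_ipnorm ipP) -powRN (_ : s - s * r = s * (1 - r)); last by ring.
  rewrite powRM ?(ltW s0) ?subr_ge0 ?(ltW r1)//.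
  by rewrite mulrCA.
have [||i2 ->] := integrable_scale s0 (f := fun tau => N (u s - u tau) ^+ 2 / (s - tau) `^ (q + 1)).
- rewrite (_ : (fun tau => _) = (fun tau => N (u s - u tau) ^+ 2 * (s - tau) `^ (- (q + 1)))).
    apply: interior_measurable => // tau tauT.
    rewrite /prop_for /continuous_at; under eq_fun do rewrite (sqr_ipnorm ipP).
    rewrite (sqr_ipnorm ipP); apply: (ncvg_ip ipP); apply: (ncvgB ipP);
      try exact: ncvg_cst; exact: u_cont_interior.
  by apply/funext => tau; rewrite powRN.
- apply: (@eq_integrable _ _ _ mu _ (measurable_itv `]0, 1[)
    (EFin \o (fun r => s `^ (- (q + 1)) * (chord2 s r * (1 - r) `^ (- (q + 1)))))).
    by move=> r; rewrite inE => /fE fr; rewrite /= fr.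
  exact: (integrableZl _ _ i1).
split=> //; rewrite (@eq_Rintegral _ _ _ mu _
  (fun r => s `^ (- (q + 1)) * (chord2 s r * (1 - r) `^ (- (q + 1))))); last first.
  by move=> r; rewrite inE => /fE.
by rewrite RintegralZl// mulrA powR_oppS// mulrCA divff ?gt_eqF// mulr1.
Qed.

Lemma caputo_integral t w : 0 < t <= T ->
  mu.-integrable `]0, t[ (EFin \o (fun tau => ip (v tau) w * (t - tau) `^ (- alpha))) /\
  \int[mu]_(tau in `]0, t[) (ip (v tau) w * (t - tau) `^ (- alpha)) =
  t `^ (- alpha) * (t *
    \int[mu]_(r in `]0, 1[) (ip (v (t * r)) w * (1 - r) `^ (- alpha))).
Proof.
move=> tT; have [_ i1] := caputo_integrable w tT; have /andP[t0 _] := tT.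
have fE r : `]0, 1[%classic r -> ip (v (t * r)) w * (t - t * r) `^ (- alpha) =
    t `^ (- alpha) * (ip (v (t * r)) w * (1 - r) `^ (- alpha)).
  rewrite /= in_itv/= => /andP[r0 r1].
  rewrite (_ : t - t * r = t * (1 - r)); last by ring.
  rewrite powRM ?(ltW t0) ?subr_ge0 ?(ltW r1)//.
  by rewrite mulrCA.
have [||i2 ->] := integrable_scale t0 (f := fun tau => ip (v tau) w * (t - tau) `^ (- alpha)).
- apply: interior_measurable => // tau tauT.
  by apply: (ncvg_ip ipP); [exact: v_cont_interior|exact: ncvg_cst].
- apply: (@eq_integrable _ _ _ mu _ (measurable_itv `]0, 1[)
    (EFin \o (fun r => t `^ (- alpha) * (ip (v (t * r)) w * (1 - r) `^ (- alpha))))).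
    by move=> r; rewrite inE => /fE fr; rewrite /= fr.
  exact: (integrableZl _ _ i1).
split=> //; rewrite (@eq_Rintegral _ _ _ mu _
  (fun r => t `^ (- alpha) * (ip (v (t * r)) w * (1 - r) `^ (- alpha)))); last first.
  by move=> r; rewrite inE => /fE.
by rewrite RintegralZl// mulrCA.
Qed.

Lemma memory_functionalE s : 0 < s <= T -> memory_functional alpha s =
  2^-1 * (s `^ (- alpha) * (ip (u s - u 0) (u s - u 0) + alpha * history s)).
Proof.
move=> sT; have [i1 _] := chord2_integrable sT.
have [_ E1] := memory_integral sT i1; have /andP[s0 _] := sT.
rewrite /memory_functional E1 (sqr_ipnorm ipP) -/(history s) powRN; field.
by rewrite gt_eqF// powR_gt0.
Qed.

(** The product rule gives the derivative of
    D_alpha(s) = s^(-alpha) / 2 * (N(u s - u 0)^2 + alpha history s); after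
    history_identity the rest is algebra. *)
Theorem caputo_energy_identity t : 0 < t <= T ->
  exists2 dD : R,
    (s - t)^-1 * (memory_functional alpha s - memory_functional alpha t)
      @[s --> within `[0, T] t^'] --> dD &
    \int[mu]_(tau in `]0, t[) (ip (v tau) (v t) * (t - tau) `^ (- alpha)) =
      dD + alpha * memory_functional (alpha + 1) t.
Proof.
move=> tT; have /andP[t0 t1] := tT.
set I := \int[mu]_(r in `]0, 1[) history_rate t r.
pose g s := ip (u s - u 0) (u s - u 0) + alpha * history s.
pose dg := 2 * ip (u t - u 0) (v t) + alpha * I.
pose df := - alpha * t `^ (- alpha - 1).
have f' : (s - t)^-1 * (s `^ (- alpha) - t `^ (- alpha)) @[s --> within `[0, T] t^'] --> df.
  have := dnbhs_is_derive (is_derive1_powR (- alpha) t0).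
  by apply: cvg_trans; apply: cvg_app; exact: cvg_within.
have tin : t \in `]0, T] by rewrite in_itv.
have g' : (s - t)^-1 * (g s - g t) @[s --> within `[0, T] t^'] --> dg.
  have -> : (fun s => (s - t)^-1 * (g s - g t)) = (fun s =>
      (s - t)^-1 * (ip (u s - u 0) (u s - u 0) - ip (u t - u 0) (u t - u 0)) +
      alpha * ((s - t)^-1 * (history s - history t))).
    by apply/funext => s; rewrite /g; ring.
  apply: cvgD; last by apply: cvgM; [exact: cvg_cst|exact: history_derive].
  apply: (cvg_quotient_sqr ipP).
    apply: (ncvgB ipP); last exact: ncvg_cst.
    apply: cvg_trans (cvg_app _ _) (u_ncvg (subset_itv_oc_cc tin)).
    by move=> P; apply: (@filterS _ (nbhs t)) => s sP _.
  rewrite [X in ncvg _ _ X _](_ : _ = (fun s => (s - t)^-1 *: (u s - u t))).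
    exact: u_deriv.
  by apply/funext => s; rewrite opprB addrA subrK.
exists (2^-1 * (df * g t + t `^ (- alpha) * dg)).
  apply: cvg_trans (cvgM (cvg_cst (2^-1 : R)) (cvg_quotientM f' g')).
  apply: near_eq_cvg.
  change (nbhs t (fun s => s != t -> `[0, T]%classic s ->
    2^-1 * ((s - t)^-1 * (s `^ (- alpha) * g s - t `^ (- alpha) * g t)) =
    (s - t)^-1 * (memory_functional alpha s - memory_functional alpha t))).
  apply: filterS (lt_nbhsr t0) => s s0 _; rewrite /= in_itv/= => /andP[_ sT].
  by rewrite !memory_functionalE// ?s0// -/(g s) -/(g t); ring.
have [i1 i2] := chord2_integrable tT.
have [_ ->] := caputo_integral (v t) tT.
rewrite (history_identity tT) /memory_functional (memory_integral tT i2).2 -/I.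
set P := \int[mu]_(r in _) _.
rewrite (sqr_ipnorm ipP) /dg /df /g -opprD powR_oppS// (powRD (s := 1)); last first.
  by rewrite (gt_eqF t0) implybT.
rewrite powRr1 ?(ltW t0)// powRN; field.
by rewrite gt_eqF//= gt_eqF// powR_gt0.
Qed.

End Curve.

(** * Bochner integrals and bounded functionals *)

Section BochnerFunctional.
Context {R : realType} {V : lmodType R} {S : set V} {N : V -> R}.
Local Notation mu := (@lebesgue_measure R).
Context (S0 : S 0) (SP : forall (a : R) x y, S x -> S y -> S (a *: x + y)).
Context (l : V -> R) (c : R).
Context (lP : forall (a : R) x y, S x -> S y -> l (a *: x + y) = a * l x + l y).
Context (lN : forall x, S x -> `|l x| <= c * N x).
Implicit Types (D : set R) (g : R -> V) (h : simple_map V).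

Let l0 : l 0 = 0.
Proof.
have := lP 1 S0 S0; rewrite scaler0 addr0 mul1r => /eqP.
by rewrite eq_sym -subr_eq0 addrK => /eqP.
Qed.

Let lsum n (F : nat -> V) (a : nat -> R) : (forall i, (i < n)%N -> S (F i)) ->
  S (\sum_(i < n) a i *: F i) /\
  l (\sum_(i < n) a i *: F i) = \sum_(i < n) a i * l (F i).
Proof.
elim: n => [|n IH] SF; first by rewrite !big_ord0.
have [Sn ln] := IH (fun i ni => SF i (ltnW ni)); have SFn := SF n (ltnSn n).
rewrite !big_ord_recr/= -ln [_ + _ *: _]addrC; split; first exact: SP.
by rewrite lP// addrC.
Qed.

Let simple_functional D h : measurable (D : set (measurableTypeR R)) -> simple_on S D h ->
  mu.-integrable D (EFin \o (fun t => l (simple_fun h t))) /\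
  \int[mu]_(t in D) l (simple_fun h t) = l (simple_integral h).
Proof.
move=> mD hP; have SF i : (i < steps h)%N -> S (step_value h i) by case/hP.
have lE t : l (simple_fun h t) =
    \sum_(i < steps h) \1_(step_set h i) t * l (step_value h i).
  by have [_ ->] := lsum (fun i => \1_(step_set h i) t) SF.
have [_ ->] := lsum (fun i => fine (mu (step_set h i))) SF.
have -> : (fun t => l (simple_fun h t)) =
    (fun t => \sum_(i < steps h) \1_(step_set h i) t * l (step_value h i)).
  exact/funext.
rewrite /simple_on in hP; move: hP; clear SF lE; elim: (steps h) => [|n IH] hP.
  under eq_fun do rewrite big_ord0; rewrite big_ord0; split.
    exact: integrable0.
  by rewrite Rintegral_cst// mul0r.
have [i1 e1] := IH (fun i ni => hP i (ltnW ni)).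
have [mA AD Afin _] := hP n (ltnSn n).
have i0 : mu.-integrable D (EFin \o \1_(step_set h n)).
  apply/integrableP; split; first by apply/measurable_EFinP; exact: measurable_indic.
  under eq_integral do rewrite /= ger0_norm//.
  by rewrite integral_indic// setIidl.
have i2 : mu.-integrable D (EFin \o (fun t => \1_(step_set h n) t * l (step_value h n))).
  rewrite (_ : _ \o _ = (fun t => (l (step_value h n))%:E * (EFin \o \1_(step_set h n)) t)%E).
    exact: integrableZl.
  by apply/funext => t /=; rewrite mulrC.
have -> : (fun t => \sum_(i < n.+1) \1_(step_set h i) t * l (step_value h i)) =
    (fun t => \sum_(i < n) \1_(step_set h i) t * l (step_value h i) +
      \1_(step_set h n) t * l (step_value h n)).
  by apply/funext => t; rewrite big_ord_recr.
rewrite big_ord_recr/=; split; first exact: (integrableD mD i1 i2).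
rewrite RintegralD// e1 RintegralZr//; congr (_ + _ * _).
by rewrite /Rintegral integral_indic// setIidl.
Qed.

(** Both sides are limits of the value of l at the integrals of the
    approximating simple maps, for which the identity is linearity. *)
Lemma bochner_functional D g w : measurable (D : set (measurableTypeR R)) ->
  is_bochner_integral S N D g w ->
  mu.-integrable D (EFin \o (fun t => l (g t))) ->
  \int[mu]_(t in D) l (g t) = l w.
Proof.
move=> mD [Sw Sg [h [hP ih hg hw]]] il.
have lB x y : S x -> S y -> l (x - y) = l x - l y.
  by move=> Sx Sy; rewrite addrC -scaleN1r lP// mulN1r addrC.
have SB x y : S x -> S y -> S (x - y).
  by move=> Sx Sy; rewrite addrC -scaleN1r; exact: SP.
have Ssimple k t : S (simple_fun (h k) t).
  by have [] := lsum (fun i => \1_(step_set (h k) i) t)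
    (fun i (ik : (i < steps (h k))%N) => let: And4 _ _ _ Sx := hP k i ik in Sx).
have Sint k : S (simple_integral (h k)).
  by have [] := lsum (fun i => fine (mu (step_set (h k) i)))
    (fun i (ik : (i < steps (h k))%N) => let: And4 _ _ _ Sx := hP k i ik in Sx).
have lim1 : l (simple_integral (h k)) @[k --> \oo] --> l w.
  apply/subr_cvg0; apply: norm_cvg0.
  have cw : c * N (simple_integral (h k) - w) @[k --> \oo] --> c * 0.
    by apply: cvgM => //; exact: cvg_cst.
  rewrite mulr0 in cw; apply: (squeeze_cvgr _ (cvg_cst 0) cw).
  by apply: nearW => k; rewrite normr_ge0 -lB// lN//; exact: SB.
have lim2 : l (simple_integral (h k)) @[k --> \oo] --> \int[mu]_(t in D) l (g t).
  apply/subr_cvg0; apply: norm_cvg0.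
  have cg : c * \int[mu]_(t in D) N (simple_fun (h k) t - g t) @[k --> \oo] --> c * 0.
    by apply: cvgM; [exact: cvg_cst|exact: (fine_cvg hg)].
  rewrite mulr0 in cg; apply: (squeeze_cvgr _ (cvg_cst 0) cg).
  apply: nearW => k; rewrite normr_ge0/=.
  have [ik <-] := simple_functional mD (hP k).
  rewrite -RintegralB//.
  have ikg : mu.-integrable D (EFin \o (fun t => l (simple_fun (h k) t) - l (g t))).
    exact: (integrableB mD ik il).
  rewrite -RintegralZl//; last exact: ih.
  apply: le_trans (le_normr_Rintegral mD ikg) _.
  apply: le_Rintegral => //; first exact: integrable_norm.
    exact: (integrableZl mD c (ih k)).
  by move=> t Dt; rewrite -lB//; [apply: lN; apply: SB => //|]; exact: Sg.
exact: (cvg_unique _ lim2 lim1).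
Qed.
End BochnerFunctional.

(** * The semi-inner product of square-integrable functions *)

Section L2Space.
Context {R : realType} {d : nat} (Omega : set 'rV[R]_d.+1).
Local Notation point := 'rV[R]_d.+1.
Local Notation leb := (lebesgue_rV R d).
Implicit Types (f g : point -> R).

Definition square_integrable : {pred point -> R} :=
  fun f => f \_ Omega \in Lfun leb 2%:E.

Lemma square_integrable_submod : submod_closed square_integrable.
Proof.
have [L0 LD] := @Lfun_submod_closed _ _ R leb 2%:E (lee1n 2).
split.
  rewrite unfold_in (_ : 0 \_ Omega = 0)//.
  by apply/funext => x; rewrite patch_indic/= mul0r.
move=> a f g; rewrite !unfold_in => fL gL.
rewrite (_ : (a *: f + g) \_ Omega = a *: (f \_ Omega) + g \_ Omega).
  exact: LD.
apply/funext => x; rewrite !patch_indic.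
change ((a * f x + g x) * \1_Omega x = a * (f x * \1_Omega x) + g x * \1_Omega x).
by ring.
Qed.

HB.instance Definition _ := GRing.isSubmodClosed.Build R (point -> R)
  square_integrable square_integrable_submod.

(** L^2(Omega) as a type, so that the additive and scalar laws hold without side
    conditions. *)
Record L2space := L2Space { L2val :> point -> R; _ : L2val \in square_integrable }.
HB.instance Definition _ := [isSub for L2val].
HB.instance Definition _ := [Choice of L2space by <:].
HB.instance Definition _ := [SubChoice_isSubLmodule of L2space by <:].

Lemma L2spaceP (f : L2space) : L2 Omega f.
Proof. by case: f. Qed.

Definition to_L2 f : L2space := insubd 0 f.

Lemma to_L2K f : L2 Omega f -> to_L2 f = f :> (point -> R).
Proof. by move=> fL; rewrite [LHS]val_insubd ifT. Qed.

Lemma integrable_L2inner f g : L2 Omega f -> L2 Omega g ->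
  leb.-integrable setT (EFin \o ((f \_ Omega) \* (g \_ Omega))).
Proof. by move=> fL gL; apply/Lfun1_integrable; exact: Lfun2_mul_Lfun1. Qed.

Lemma L2innerE f g : L2inner Omega f g =
  \int[leb]_x ((f \_ Omega) x * (g \_ Omega) x).
Proof.
rewrite /L2inner Rintegral_mkcond; apply: eq_Rintegral => x _.
by rewrite !patchE; case: ifP => //= _; rewrite mulr0.
Qed.

Definition L2ip (f g : L2space) : R := L2inner Omega f g.

Lemma L2inner_linear a f g k : L2 Omega f -> L2 Omega g -> L2 Omega k ->
  L2inner Omega (a *: f + g) k = a * L2inner Omega f k + L2inner Omega g k.
Proof.
move=> fL gL kL; rewrite !L2innerE.
have ifk := integrable_L2inner fL kL; have igk := integrable_L2inner gL kL.
rewrite -RintegralZl// -RintegralD//.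
  apply: eq_Rintegral => x _; rewrite !patch_indic.
  change ((a * f x + g x) * \1_Omega x * (k x * \1_Omega x) =
    a * (f x * \1_Omega x * (k x * \1_Omega x)) + g x * \1_Omega x * (k x * \1_Omega x)).
  by ring.
exact: (integrableZl _ a ifk).
Qed.

Lemma L2ip_semi_inner : semi_inner L2ip.
Proof.
split.
- by move=> f g; rewrite /L2ip /L2inner; apply: eq_Rintegral => x _; rewrite mulrC.
- by move=> a f g k; rewrite /L2ip L2inner_linear//; exact: L2spaceP.
- by move=> f; rewrite /L2ip /L2inner; apply: Rintegral_ge0 => x _; rewrite -expr2 sqr_ge0.
Qed.

Lemma ipnorm_L2 (f : L2space) : ipnorm L2ip f = L2norm Omega f.
Proof. by []. Qed.

Lemma L2_submod a f g : L2 Omega f -> L2 Omega g -> L2 Omega (a *: f + g).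
Proof. exact: square_integrable_submod.2. Qed.

Lemma L2_0 : L2 Omega 0.
Proof. exact: square_integrable_submod.1. Qed.

Lemma L2innerZ a f g : L2 Omega f -> L2 Omega g ->
  L2inner Omega (a *: f) g = a * L2inner Omega f g.
Proof.
move=> /to_L2K fE /to_L2K gE; rewrite -fE -gE.
exact: (ipZl L2ip_semi_inner a (to_L2 f) (to_L2 g)).
Qed.

Lemma L2inner_CauchySchwarz f g : L2 Omega f -> L2 Omega g ->
  `|L2inner Omega f g| <= L2norm Omega f * L2norm Omega g.
Proof.
move=> /to_L2K fE /to_L2K gE; have := ip_CauchySchwarz L2ip_semi_inner (to_L2 f) (to_L2 g).
by rewrite /ipnorm /L2ip fE gE.
Qed.

End L2Space.
Arguments L2ip {R d} Omega f g.

(** * The time-fractional Allen-Cahn problem *)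

Theorem lemma3p1 (R : realType) (d : nat) (Omega : set 'rV[R]_d.+1)
    (alpha gamma epsilon T : R) (u0 : 'rV[R]_d.+1 -> R)
    (u : R -> 'rV[R]_d.+1 -> R) :
  bounded_domain Omega -> lipschitz_boundary Omega ->
  0 < alpha < 1 -> 0 < gamma -> 0 < epsilon -> 0 < T ->
  Hk Omega 2 u0 -> H10 Omega u0 ->
  allen_cahn_solution Omega alpha gamma epsilon T u0 u ->
  forall t : R, 0 < t <= T ->
  [/\ lebesgue_measure.-integrable `]0, t[
        (EFin \o D_integrand Omega alpha u t),
      lebesgue_measure.-integrable `]0, t[
        (EFin \o D_integrand Omega (alpha + 1) u t) &
      exists2 dD : R^o,
        is_deriv_on (V := R^o) Num.norm `[0, T]
          (D_functional Omega alpha u) t dD &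
        Gamma (1 - alpha) *
          L2inner Omega (caputo Omega alpha T u t) (time_deriv Omega T u t) =
        dD + alpha * D_functional Omega (alpha + 1) u t].
Proof.
move=> _ _ alpha01 _ _ T0 _ _ [[_ _ _ [C1 uC] _ capdef _ derdef vC [C2 vb]] _ _ _] t tT.
have /andP[a0 a1] := alpha01; have /andP[t0 t1] := tT.
have ipP := L2ip_semi_inner Omega.
have [U UE] : exists U : R -> L2space Omega, forall s, s \in `[0, T] -> U s = u s :> (_ -> _).
  exists (fun s => to_L2 Omega (u s)) => s sT.
  by apply: to_L2K; have [] := uC s s sT sT.
have [v vdef] : exists v, v = time_deriv Omega T u by exists (time_deriv Omega T u).
rewrite -vdef in vC vb *.
have [W WE] : exists W : R -> L2space Omega, forall s, s \in `]0, T] -> W s = v s :> (_ -> _).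
  exists (fun s => to_L2 Omega (v s)) => s sT.
  by apply: to_L2K; have [] := vC s sT.
have tin : t \in `]0, T] by rewrite in_itv.
have tin0 := subset_itv_oc_cc tin.
have UB s r : s \in `[0, T] -> r \in `[0, T] ->
    ipnorm (L2ip Omega) (U s - U r) = L2norm Omega (u s - u r).
  by move=> sT rT; rewrite ipnorm_L2 -(UE s sT) -(UE r rT).
have U_holder s r : s \in `[0, T] -> r \in `[0, T] ->
    ipnorm (L2ip Omega) (U r - U s) <= C1 * `|s - r| `^ alpha.
  by move=> sT rT; rewrite UB// distrC; have [] := uC s r sT rT; rewrite distrC.
have U_deriv s : s \in `]0, T] ->
    ncvg (L2ip Omega) (within `[0, T] s^') (fun r => (r - s)^-1 *: (U r - U s)) (W s).
  move=> sT; have [w Lw ws] := derdef s sT.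
  have [_ vs] : L2 Omega (v s) /\ is_deriv_on (L2norm Omega) `[0, T] u s (v s).
    have ex : exists x, [set x | L2 Omega x /\
        is_deriv_on (L2norm Omega) `[0, T] u s x] x by exists w.
    by rewrite vdef; exact: (xgetPex 0 ex).
  apply: cvg_trans vs; apply: near_eq_cvg.
  change (nbhs s (fun r => r != s -> `[0, T]%classic r ->
    L2norm Omega ((r - s)^-1 *: (u r - u s) - v s) =
    ipnorm (L2ip Omega) ((r - s)^-1 *: (U r - U s) - W s))).
  apply: (@filterE _ (nbhs s)) => r _ rT.
  by rewrite ipnorm_L2 -(UE r rT) -(UE s (subset_itv_oc_cc sT)) -(WE s sT).
have W_cont s : s \in `]0, T] -> ncvg (L2ip Omega) (within `]0, T] (nbhs s)) W (W s).
  move=> sT; have [_ vs] := vC s sT; apply: cvg_trans vs; apply: near_eq_cvg.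
  change (nbhs s (fun r => `]0, T]%classic r ->
    L2norm Omega (v r - v s) = ipnorm (L2ip Omega) (W r - W s))).
  apply: (@filterE _ (nbhs s)) => r rT.
  by rewrite ipnorm_L2 -(WE r rT) -(WE s sT).
have W_bound s : s \in `]0, T] -> ipnorm (L2ip Omega) (W s) <= C2 * s `^ (alpha - 1).
  by move=> sT; rewrite ipnorm_L2 WE//; exact: vb.
have [i1 i2] := chord2_integrable ipP alpha01 T0 U_holder U_deriv W_bound tT.
have [j1 _] := memory_integral ipP alpha01 U_holder tT i1.
have [j2 _] := memory_integral ipP alpha01 U_holder tT i2.
have DE beta s tau : s \in `[0, T] -> tau \in `[0, s] ->
   D_integrand Omega beta u s tau =
   ipnorm (L2ip Omega) (U s - U tau) ^+ 2 / (s - tau) `^ (beta + 1).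
  move=> /[dup] sT; rewrite !in_itv/= => /andP[s0 s1] /andP[tau0 taus].
  by rewrite /D_integrand UB// in_itv/= tau0 (le_trans taus).
have FE beta s : s \in `[0, T] ->
    D_functional Omega beta u s = memory_functional U beta s (ip := L2ip Omega).
  move=> sT; have s0 : 0 <= s by move: sT; rewrite in_itv => /andP[].
  have zT : 0 \in `[0, T] by rewrite in_itv/= lexx ltW.
  have e0 := UB _ _ sT zT.
  rewrite /D_functional /memory_functional e0 (@eq_Rintegral _ _ _ lebesgue_measure _
    (fun tau => ipnorm (L2ip Omega) (U s - U tau) ^+ 2 / (s - tau) `^ (beta + 1)))//.
  by move=> tau; rewrite inE => taus; apply: DE => //; exact: subset_itv_oo_cc taus.
have [dD dDt E] := caputo_energy_identity ipP alpha01 T0 U_holder U_deriv W_cont W_bound tT.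
have intE beta : lebesgue_measure.-integrable `]0, t[ (EFin \o
      (fun tau => ipnorm (L2ip Omega) (U t - U tau) ^+ 2 / (t - tau) `^ (beta + 1))) ->
    lebesgue_measure.-integrable `]0, t[ (EFin \o D_integrand Omega beta u t).
  apply: eq_integrable => // tau; rewrite inE => taut.
  by rewrite /= DE//; exact: subset_itv_oo_cc taut.
split; [exact: intE|exact: intE|exists dD].
  have h : `|(s - t)^-1 * (memory_functional U alpha s (ip := L2ip Omega) -
      memory_functional U alpha t (ip := L2ip Omega)) - dD|
      @[s --> within `[0, T] t^'] --> `|dD - dD|.
    by apply: cvg_norm; apply: cvgB dDt _; exact: cvg_cst.
  rewrite subrr normr0 in h; apply: cvg_trans h; apply: near_eq_cvg.
  change (nbhs t (fun s => s != t -> `[0, T]%classic s ->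
    `|(s - t)^-1 * (memory_functional U alpha s (ip := L2ip Omega) -
      memory_functional U alpha t (ip := L2ip Omega)) - dD| =
    `|(s - t)^-1 * (D_functional Omega alpha u s - D_functional Omega alpha u t) - dD|)).
  by apply: (@filterE _ (nbhs t)) => s _ sT; rewrite !FE.
have G0 : Gamma (1 - alpha) != 0 by rewrite gt_eqF// Gamma_gt0//; apply/andP; split; lra.
set B := bochner_integral (L2 Omega) (L2norm Omega) `]0, t[ (caputo_integrand Omega alpha T u t).
have BP : is_bochner_integral (L2 Omega) (L2norm Omega) `]0, t[
    (caputo_integrand Omega alpha T u t) B.
  exact: (xgetPex 0 (capdef t tin)).
have LB : L2 Omega B by case: BP.
have Lv s : s \in `]0, T] -> L2 Omega (v s) by move=> sT; have [] := vC s sT.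
have [ic _] := caputo_integral ipP alpha01 W_cont W_bound (W t) tT.
have cE tau : tau \in `]0, t[ ->
    L2inner Omega (caputo_integrand Omega alpha T u t tau) (v t) =
    L2ip Omega (W tau) (W t) * (t - tau) `^ (- alpha).
  rewrite in_itv/= => /andP[tau0 taut].
  have tauT : tau \in `]0, T] by rewrite in_itv/= tau0 (le_trans (ltW taut)).
  rewrite /L2ip (WE _ tauT) (WE _ tin) mulrC /caputo_integrand -vdef.
  by apply: L2innerZ; exact: Lv.
rewrite FE// -E /caputo -/B L2innerZ//; last exact: Lv.
rewrite mulrA divff// mul1r.
rewrite -(@bochner_functional R _ (L2 Omega) (L2norm Omega) (L2_0 Omega)
  (@L2_submod R d Omega) (fun f => L2inner Omega f (v t)) (L2norm Omega (v t)) _ _ _ _ _ _ BP).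
- by apply: eq_Rintegral => tau; rewrite inE => /cE.
- by move=> a f g fL gL; apply: L2inner_linear => //; exact: Lv.
- by move=> f fL; rewrite mulrC; apply: L2inner_CauchySchwarz => //; exact: Lv.
- by [].
- apply: eq_integrable ic => // tau; rewrite inE => /cE taut.
  by rewrite /= taut.
Qed.
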